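(* Let $K\subseteq\mathbb{R}^n$ be compact, let $X\subseteq K$ be a finite set and let $\mu$ be a positive discrete measure supported on $X$. Suppose that the ideal $I(X)\subseteq\mathbb{R}[x_1,\dots,x_n]$ of polynomials vanishing on $X$ admits a set of $s$ generators of degree $\leq g$. Then there exists a positive constant $D$ such that for all sufficiently large even integers $m$ the following holds. Let $d\geq 2(m-1)g$, let $\phi_1,\dots,\phi_T$ be a basis of $V_{\leq d}$ which is orthonormal with respect to some probability measure on $K$, let $\delta\ge 0$, let $\epsilon\in\mathbb{R}^T$ with $\|\epsilon\|_2\leq\delta$, put $y_i:=\int_K\phi_i\,d\mu+\epsilon_i$ for $i=1,\dots,T$, and let $\hat\Delta$ be a discrete minimizer of $$\min_{\nu\in\mathcal{S}(K)}\|\nu\|_{\rm TV}\quad\text{subject to}\quad\left\|\left(\int_K\phi_i\,d\nu-y_i\right)_{i=1,\dots,T}\right\|_2\leq\delta .$$ Set $c_0:=\frac1m\sqrt{\frac{3!}{D}}$. Then: 1. If $z\in K$ is such that $\hat\Delta(z)>4s\delta$ then $d(X,z)\leq c_0$. 2. The following inequalities hold: $$\sum_{z\in N(X,c_0),\ \hat\Delta(z)>0}\hat\Delta(z)\,d(X,z)^2\leq\left(\frac{3!\cdot 4s}{m^2D}\right)\delta,$$ $$\sum_{z\in F(X,c_0),\ \hat\Delta(z)>0}\hat\Delta(z)\leq 2s\delta,$$ $$\sum_{z:\ \hat\Delta(z)<0}|\hat\Delta(z)|\leq 2\delta.$$ 3. If $x^*\in X$ then $$\left|\mu(x^* )-\sum_{z:\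 d(z,x^* )\leq c_0}\hat\Delta(z)\right|\leq\frac1m\|\mu\|_{\rm TV}+\left(2(s+1)+\frac{3!\cdot 2s\pi^2}{\mathrm{diam}(K)^2D}\right)\delta .$$
   Context: $V_{\leq d}$ is the vector space of real polynomials in $n$ variables of degree at most $d$. $\mathcal{S}(K)$ is the set of all real-valued signed Borel measures on $K$, and $\|\nu\|_{\rm TV}:=\sup\{\int_K f\,d\nu: f\text{ continuous on }K,\ \|f\|_\infty\leq1\}$. A positive discrete measure supported on $X$ is a measure $\sum_{x\in X}c_x\delta_x$ with all $c_x\geq0$; a discrete minimizer is a minimizer that is a finite real linear combination of Dirac measures at points of $K$. For a discrete (signed) measure $\Delta$ and $z\in K$, $\Delta(z)$ denotes the coefficient of $\delta_z$ in the unique decomposition of $\Delta$ as a linear combination of Dirac measures (it is $0$ for all but finitely many $z$). $d(X,z)=d(z,X)$ is the Euclidean distance from the point $z$ to $X$, and $d(z,x^* )$ the Euclidean distance between two points. $N(X,r)$ (resp. $F(X,r)$) is the set of points of $K$ at distance at most (resp. at least) $r$ from $X$. $\mathrm{diam}(K)$ is the largest distance between two points of $K$. *)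

(* Defs.v *)
(* MathComp-Analysis, with {mpoly R[n]} from multinomials.  The notations of
   mpoly clash with those of MathComp-Analysis, hence [Import -(notations)]. *)
From HB Require Import structures.
From mathcomp Require Import all_boot all_order all_algebra finmap.
From mathcomp Require Import all_classical all_reals all_analysis.
From mathcomp.multinomials Require Import -(notations) mpoly.

Set Implicit Arguments.
Unset Strict Implicit.
Unset Printing Implicit Defensive.

Import Order.TTheory GRing.Theory Num.Theory.
Import numFieldNormedType.Exports.

Local Open Scope classical_set_scope.
Local Open Scope ring_scope.

Notation borel R n := (g_sigma_algebraType (@open 'rV[R]_n)).

(* Real-valued signed Borel measures on R^n: library charges take finite values
   on measurable sets. *)
Notation signed_measure R n := (charge (borel R n) R).

Section EuclideanGeometry.
Context {R : realType} {n : nat}.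
Implicit Types (x y z : 'rV[R]_n) (K X : set 'rV[R]_n).

(* The library norm on 'rV[R]_n is the sup norm; it induces the same topology. *)
Definition norm2 x : R := Num.sqrt (\sum_(i < n) x ord0 i ^+ 2).

Definition dist2 x y : R := norm2 (x - y).

(* Extended-real valued, so that the distance to the empty set is +oo. *)
Definition dist2_set z X : \bar R := ereal_inf [set (dist2 z x)%:E | x in X].

Definition near_set K X (r : R) : set 'rV[R]_n :=
  [set z | K z /\ (dist2_set z X <= r%:E)%E].

Definition far_set K X (r : R) : set 'rV[R]_n :=
  [set z | K z /\ (r%:E <= dist2_set z X)%E].

Definition diam K : R := sup [set r | exists x y, [/\ K x, K y & r = dist2 x y]].

End EuclideanGeometry.

Section Polynomials.
Context {R : realType} {n : nat}.

Definition peval (p : mpoly n R) (x : 'rV[R]_n) : R := meval (x ord0) p.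

(* [msize p] is 1 + deg p, and 0 for p = 0. *)
Definition deg_le (d : nat) (p : mpoly n R) : Prop := (msize p <= d.+1)%N.

Definition vanishing_ideal (X : set 'rV[R]_n) : set (mpoly n R) :=
  [set p | forall x, X x -> peval p x = 0].

Definition ideal_gen (s : nat) (h : 'I_s -> mpoly n R) : set (mpoly n R) :=
  [set p | exists q : 'I_s -> mpoly n R, p = \sum_(i < s) q i * h i].

Definition basis_deg_le (d T : nat) (phi : 'I_T -> mpoly n R) : Prop :=
  [/\ forall i, deg_le d (phi i),
      forall a : 'I_T -> R,
        \sum_(i < T) a i *: phi i = 0 -> forall i, a i = 0 &
      forall p, deg_le d p ->
        exists a : 'I_T -> R, p = \sum_(i < T) a i *: phi i].

(* A probability measure on K is encoded as one on R^n giving K mass 1. *)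
Definition orthonormal_on (K : set 'rV[R]_n) (T : nat)
    (phi : 'I_T -> mpoly n R) : Prop :=
  exists P : probability (borel R n) R, P K = 1%E /\
    forall i j, \int[P]_(x in K) (peval (phi i) x * peval (phi j) x)
                = (i == j)%:R.

End Polynomials.

Section SignedMeasures.
Context {R : realType} {n : nat}.
Implicit Types (K : set 'rV[R]_n) (nu : signed_measure R n).

Definition hahn_pos nu : set (borel R n) :=
  projT1 (cid (Hahn_decomposition nu)).

Definition hahn_neg nu : set (borel R n) :=
  projT1 (cid (projT2 (cid (Hahn_decomposition nu)))).

Lemma hahnP nu : hahn_decomposition nu (hahn_pos nu) (hahn_neg nu).
Proof. exact: (projT2 (cid (projT2 (cid (Hahn_decomposition nu))))). Qed.

(* The library has no integral against a charge: it is defined by the Jordan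
   decomposition, which does not depend on the chosen Hahn decomposition. *)
Definition sintegral nu K (f : 'rV[R]_n -> R) : R :=
  \int[jordan_pos (hahnP nu)]_(x in K) f x
  - \int[jordan_neg (hahnP nu)]_(x in K) f x.

(* A signed Borel measure on K is encoded as one on R^n that vanishes on all
   Borel sets disjoint from K. *)
Definition carried_by K nu : Prop :=
  forall A : set (borel R n), measurable A -> A `&` K = set0 -> nu A = 0%E.

Definition tv_norm K nu : \bar R :=
  ereal_sup [set (sintegral nu K f)%:E | f in
    [set f : 'rV[R]_n -> R |
      {within K, continuous f} /\ forall x, K x -> `|f x| <= 1]].

End SignedMeasures.

Section DiscreteMeasures.
Context {R : realType} {n : nat}.
Variable c : {fsfun 'rV[R]_n -> R with 0}.

(* The coefficient of the Dirac measure at z in [discrete_measure c] is [c z]. *)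
Definition discrete_measure (A : set (borel R n)) : \bar R :=
  (\sum_(x <- finsupp c) (c x)%:E * \d_(x : borel R n) A)%E.

Let is_charge : exists nu : signed_measure R n,
  forall A, nu A = discrete_measure A.
Proof.
rewrite /discrete_measure; elim: (enum_fset (finsupp c)) => [|x r [nu nuE]].
  by exists czero => A; rewrite big_nil.
exists (cadd (cscale (c x) (charge_of_finite_measure \d_(x : borel R n))) nu).
by move=> A; rewrite big_cons -nuE.
Qed.

Let discrete_measureE : exists nu : signed_measure R n,
  discrete_measure = nu :> (set (borel R n) -> \bar R).
Proof. by have [nu nuE] := is_charge; exists nu; apply/funext. Qed.

Let discrete_measure0 : discrete_measure set0 = 0%E.
Proof. by have [nu ->] := discrete_measureE; exact: charge0. Qed.

Let discrete_measure_fin A : measurable A -> discrete_measure A \is a fin_num.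
Proof. by have [nu ->] := discrete_measureE => mA; exact: fin_num_measure. Qed.

Let discrete_measure_sigma_additive : semi_sigma_additive discrete_measure.
Proof.
by have [nu ->] := discrete_measureE; exact: charge_semi_sigma_additive.
Qed.

HB.instance Definition _ := isCharge.Build _ _ _ discrete_measure
  discrete_measure0 discrete_measure_fin discrete_measure_sigma_additive.

End DiscreteMeasures.

Section Recovery.
Context {R : realType} {n T : nat}.
Variables (K : set 'rV[R]_n) (phi : 'I_T -> mpoly n R).

Definition moments (nu : signed_measure R n) : 'rV[R]_T :=
  \row_(i < T) sintegral nu K (peval (phi i)).

Variables (y : 'rV[R]_T) (delta : R).

Definition feasible (nu : signed_measure R n) : Prop :=
  carried_by K nu /\ norm2 (moments nu - y) <= delta.

Definition tv_minimizer (nu : signed_measure R n) : Prop :=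
  feasible nu /\
  forall nu' : signed_measure R n, feasible nu' ->
    (tv_norm K nu <= tv_norm K nu')%E.

End Recovery.

(* Main.v *)
(* If p has degree at most d and |p| <= M on K, orthonormality bounds the l2 norm
   of its coefficients by M, so its integrals against the minimizer Delta and
   against mu differ by at most 2 delta M.  Since moreover |Delta| <= |mu|,
   applying this to 1 - 2p, for p vanishing on X with 0 <= p <= 1 on K, gives
     int p dDelta^+ + int (1 - p) dDelta^- <= delta.
   The witnesses p are built from the generators h_i: with w = (h_i / M)^2 and the
   logistic map w_0 = w, w_{k+1} = 4 w_k (1 - w_k), put p = 1 - prod_{k < r} (1 - w_k).
   Since w_r = 4^r w prod_{k < r} (1 - w_k), this p, of degree 2 (2^r - 1) in h_i,
   is at least min (1/2, 4^r w / 8) when r > 0: with 2^r <= m < 2^(r+1) it has the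
   quadratic growth of order m^2 usually obtained from Chebyshev polynomials.
   Moreover sum_i h_i^2 dominates the squared distance to X, because the polynomials
   (X_j - x_j) prod_{x' <> x} |X - x'|^2 belong to I(X).  The third item tests Delta
   against a fixed interpolating polynomial that is flat at the points of X; its sup
   norm is absorbed by choosing D small. *)
Require Import Defs.
From HB Require Import structures.
From mathcomp Require Import all_boot all_order all_algebra finmap.
From mathcomp Require Import all_classical all_reals all_analysis.
From mathcomp Require Import ring lra.
From mathcomp.multinomials Require Import -(notations) mpoly.

Set Implicit Arguments.
Unset Strict Implicit.
Unset Printing Implicit Defensive.

Import Order.TTheory GRing.Theory Num.Theory.
Import numFieldNormedType.Exports.

Local Open Scope classical_set_scope.
Local Open Scope ring_scope.

(** * Cauchy-Schwarz and the Euclidean norm *)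

Section CauchySchwarz.
Context {R : realType}.

(** Lagrange's identity: the double sum of the squares [(a i * b j - a j * b i) ^+ 2] is twice the
    difference of the two sides. *)
Lemma sum_mulr_sqr_le (n : nat) (a b : 'I_n -> R) :
  (\sum_i a i * b i) ^+ 2 <= (\sum_i a i ^+ 2) * (\sum_i b i ^+ 2).
Proof.
have : 0 <= \sum_i \sum_j (a i * b j - a j * b i) ^+ 2.
  by apply: sumr_ge0 => i _; apply: sumr_ge0 => j _; exact: sqr_ge0.
have -> : \sum_i \sum_j (a i * b j - a j * b i) ^+ 2 =
    \sum_i (a i ^+ 2 * (\sum_j b j ^+ 2) - 2 * (a i * b i) * (\sum_j a j * b j)
             + b i ^+ 2 * (\sum_j a j ^+ 2)).
  apply: eq_bigr => i _; rewrite !mulr_sumr -sumrB -big_split /=.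
  by apply: eq_bigr => j _; ring.
rewrite big_split /= sumrB -!mulr_suml -mulr_sumr; lra.
Qed.

Lemma norm2_ge0 (n : nat) (x : 'rV[R]_n) : 0 <= norm2 x.
Proof. exact: sqrtr_ge0. Qed.

Lemma norm2_sqr (n : nat) (x : 'rV[R]_n) : norm2 x ^+ 2 = \sum_i x ord0 i ^+ 2.
Proof. by rewrite sqr_sqrtr // sumr_ge0 // => i _; rewrite sqr_ge0. Qed.

Lemma norm2N (n : nat) (x : 'rV[R]_n) : norm2 (- x) = norm2 x.
Proof. by congr Num.sqrt; apply: eq_bigr => i _; rewrite mxE sqrrN. Qed.

Lemma norm_sum_mul_le (n : nat) (a : 'I_n -> R) (x : 'rV[R]_n) (M : R) :
  0 <= M -> \sum_i a i ^+ 2 <= M ^+ 2 ->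
  `|\sum_i a i * x ord0 i| <= M * norm2 x.
Proof.
move=> M0 aM.
rewrite -(ler_pXn2r (n := 2)) ?nnegrE ?mulr_ge0 ?norm2_ge0 //.
rewrite real_normK ?num_real // exprMn norm2_sqr.
apply: le_trans (sum_mulr_sqr_le _ _) _; apply: ler_wpM2r => //.
by apply: sumr_ge0 => i _; rewrite sqr_ge0.
Qed.

End CauchySchwarz.

(** * The logistic map and its product kernel *)

(* With w = sin^2 a one has [logistic i w] = sin^2 (2^i a), and [logprod r w]
   is the Fejer-type kernel (sin (2^r a) / (2^r sin a))^2. *)
Section Logistic.
Context {A : comNzRingType}.

Fixpoint logistic (i : nat) (w : A) : A :=
  if i is j.+1 then 4 * logistic j w * (1 - logistic j w) else w.

Definition logprod (r : nat) (w : A) : A := \prod_(i < r) (1 - logistic i w).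

Lemma logprodS r w : logprod r.+1 w = logprod r w * (1 - logistic r w).
Proof. by rewrite /logprod big_ord_recr. Qed.

(** Each iterate is the previous one times [4 * (1 - logistic j w)], so the factors accumulate into
    the product. *)
Lemma logisticE r w : logistic r w = 4 ^+ r * w * logprod r w.
Proof.
elim: r => [|r IH]; first by rewrite /logprod big_ord0 expr0 mul1r mulr1.
by rewrite logprodS /= {1}IH exprS !mulrA.
Qed.

Lemma logistic0 i : logistic i 0 = 0.
Proof. by elim: i => //= i ->; rewrite mulr0 mul0r. Qed.

Lemma logprod0 r : logprod r 0 = 1.
Proof. by rewrite /logprod big1 // => i _; rewrite logistic0 subr0. Qed.

End Logistic.

Lemma rmorph_logistic (A B : comNzRingType) (f : {rmorphism A -> B}) i w :
  f (logistic i w) = logistic i (f w).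
Proof. by elim: i => //= i IH; rewrite !rmorphM rmorphB rmorph1 rmorph_nat IH. Qed.

(** Used with evaluation as the morphism: the real inequalities below then apply to the values of
    the polynomial [logprod]. *)
Lemma rmorph_logprod (A B : comNzRingType) (f : {rmorphism A -> B}) r w :
  f (logprod r w) = logprod r (f w).
Proof.
rewrite /logprod rmorph_prod; apply: eq_bigr => i _.
by rewrite rmorphB rmorph1 rmorph_logistic.
Qed.

Section LogisticBounds.
Context {R : realType}.
Implicit Types w : R.

Lemma logistic_itv i w : 0 <= w <= 1 -> 0 <= logistic i w <= 1.
Proof.
move=> w01; elim: i => //= i /andP[l0 l1].
rewrite !mulr_ge0 ?subr_ge0 //=.
have := sqr_ge0 (1 - 2 * logistic i w); nra.
Qed.

Lemma logprod_itv r w : 0 <= w <= 1 -> 0 <= logprod r w <= 1.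
Proof.
move=> w01; rewrite /logprod prodr_ge0 => [|i _] /=; last first.
  by rewrite subr_ge0; case/andP: (logistic_itv i w01).
apply: prodr_ile1 => i _; have := logistic_itv i w01; lra.
Qed.

(* Either the product is already at most 1/2, or all its partial products exceed
   1/2, and then the last logistic iterate is at least 4^r w / 2. *)
Lemma one_sub_logprod_ge r w : 0 <= w <= 1 ->
  Num.min (1 / 2) (4 ^+ r * w / 2) <= 1 - logprod r.+1 w.
Proof.
move=> w01; have [w0 w1] := andP w01; rewrite ge_min.
have [|lt_half] := lerP (logprod r.+1 w) (1 / 2).
  by move=> ?; apply/orP; left; lra.
apply/orP; right.
move: lt_half; rewrite logprodS; have := logistic_itv r w01.
have := logprod_itv r w01; have := logisticE r w.
have : 0 <= 4 ^+ r * w by rewrite mulr_ge0 // exprn_ge0.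
move: (4 ^+ r * w) (logprod r w) (logistic r w) => p v l p0 -> v01 l01 h.
nra.
Qed.

End LogisticBounds.

(** * Polynomial functions: bounds, Lipschitz estimates, continuity *)

Section Evaluation.
Context {R : realType} {n : nat}.
Implicit Types (p q : mpoly n R) (x z : 'rV[R]_n) (K : set 'rV[R]_n).

Lemma pevalD p q x : peval (p + q) x = peval p x + peval q x.
Proof. exact: mevalD. Qed.

Lemma pevalB p q x : peval (p - q) x = peval p x - peval q x.
Proof. exact: mevalB. Qed.

Lemma pevalM p q x : peval (p * q) x = peval p x * peval q x.
Proof. exact: mevalM. Qed.

Lemma pevalZ (a : R) p x : peval (a *: p) x = a * peval p x.
Proof. exact: mevalZ. Qed.

Lemma pevalC (a : R) x : peval (mpolyC n a) x = a.
Proof. exact: mevalC. Qed.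

Lemma peval1 x : peval 1 x = 1.
Proof. exact: meval1. Qed.

Lemma peval_coord (i : 'I_n) x : peval (mpolyX R (mnm1 i)) x = x ord0 i.
Proof. exact: mevalXU. Qed.

Lemma pevalX p k x : peval (p ^+ k) x = peval p x ^+ k.
Proof. exact: (rmorphXn (meval (x ord0))). Qed.

Lemma peval_sum (I : Type) (r : seq I) (P : pred I) (F : I -> mpoly n R) x :
  peval (\sum_(i <- r | P i) F i) x = \sum_(i <- r | P i) peval (F i) x.
Proof. exact: (rmorph_sum (meval (x ord0))). Qed.

Lemma peval_prod (I : Type) (r : seq I) (P : pred I) (F : I -> mpoly n R) x :
  peval (\prod_(i <- r | P i) F i) x = \prod_(i <- r | P i) peval (F i) x.
Proof. exact: (rmorph_prod (meval (x ord0))). Qed.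

(** Reduces boundedness, the Lipschitz estimate and continuity to closure under sums and products,
    with no reference to monomials. *)
Lemma peval_ind (Q : ('rV[R]_n -> R) -> Prop) :
  (forall a, Q (fun=> a)) -> (forall i, Q (fun x => x ord0 i)) ->
  (forall f1 f2, Q f1 -> Q f2 -> Q (fun x => f1 x + f2 x)) ->
  (forall f1 f2, Q f1 -> Q f2 -> Q (fun x => f1 x * f2 x)) ->
  forall p, Q (peval p).
Proof.
move=> Qc Qx QD QM; have QP (I : Type) (r : seq I) (f : I -> 'rV[R]_n -> R) :
    (forall i, Q (f i)) -> Q (fun x => \prod_(i <- r) f i x).
  move=> Qf; elim: r => [|i r IH].
    by rewrite (_ : (fun _ => _) = fun=> 1) //; apply/funext => x; rewrite big_nil.
  rewrite (_ : (fun _ => _) = fun x => f i x * \prod_(j <- r) f j x); first exact: QM.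
  by apply/funext => x; rewrite big_cons.
elim/mpolyind => [|a m p _ _ Qp].
  rewrite (_ : peval 0 = fun=> 0) //; apply/funext => x.
  exact: meval0.
rewrite (_ : peval _ = fun x => a * (\prod_(i < n) \prod_(j < m i) x ord0 i)
                                + peval p x).
  by apply: (QD) => //; apply: (QM) => //; apply: (QP) => i; apply: (QP) => j.
apply/funext => x; rewrite pevalD pevalZ /peval mevalX.
by congr (_ * _ + _); apply: eq_bigr => i _; rewrite prodr_const card_ord.
Qed.

Lemma peval_bounded K p : compact K ->
  exists2 M : R, 1 <= M & forall z, K z -> `|peval p z| <= M.
Proof.
move=> cK; suff [M hM] : exists M : R, forall z, K z -> `|peval p z| <= M.
  exists (Num.max 1 M); first by rewrite le_max lexx.
  by move=> z Kz; rewrite le_max hM // orbT.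
apply: (peval_ind (Q := fun f => exists M : R, forall z, K z -> `|f z| <= M)) p
  => [a|i|f1 f2 [M1 h1] [M2 h2]|f1 f2 [M1 h1] [M2 h2]].
- by exists `|a|.
- have [B [_ hB]] := compact_bounded cK.
  exists (B + 1) => z Kz; have := hB (B + 1) _ z Kz.
  rewrite ltrDl ltr01 => /(_ isT); apply: le_trans.
  rewrite [leRHS](mx_normrE z).
  exact: (le_bigmax _ (fun ij : 'I_1 * 'I_n => `|z ij.1 ij.2|) (ord0, i)).
- exists (M1 + M2) => z Kz; apply: le_trans (ler_normD _ _) _.
  by apply: lerD; [exact: h1|exact: h2].
- exists (M1 * M2) => z Kz; rewrite normrM.
  by apply: ler_pM; rewrite ?normr_ge0 ?h1 ?h2.
Qed.

Lemma peval_lipschitz K x p : compact K ->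
  exists2 L : R, 0 <= L &
    forall z, K z -> (peval p z - peval p x) ^+ 2 <= L * dist2 z x ^+ 2.
Proof.
move=> cK.
(* The induction also records that the function is polynomial, so that [peval_bounded] applies to a
   factor in the product case. *)
suff [_ [L [L0 hL]]] : (exists q, peval p = peval q) /\ exists L : R, 0 <= L /\
    forall z, K z -> (peval p z - peval p x) ^+ 2 <= L * dist2 z x ^+ 2.
  by exists L.
apply: (peval_ind (Q := fun f => (exists q, f = peval q) /\
  exists L : R, 0 <= L /\ forall z, K z -> (f z - f x) ^+ 2 <= L * dist2 z x ^+ 2))
  p => [a|i|_ _ [[q1 ->] [L1 [L10 h1]]] [[q2 ->] [L2 [L20 h2]]]
           |_ _ [[q1 ->] [L1 [L10 h1]]] [[q2 ->] [L2 [L20 h2]]]]; split.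
- by exists (mpolyC n a); apply/funext => z; rewrite pevalC.
- by exists 0; split => // z _; rewrite subrr expr0n mul0r.
- by exists (mpolyX R (mnm1 i)); apply/funext => z; rewrite peval_coord.
- exists 1; split => // z _; rewrite mul1r norm2_sqr (bigD1 i) //= !mxE.
  by rewrite lerDl sumr_ge0 // => j _; rewrite sqr_ge0.
- by exists (q1 + q2); apply/funext => z; rewrite pevalD.
- exists (2 * L1 + 2 * L2); split => [|z Kz]; first lra.
  move: (h1 _ Kz) (h2 _ Kz) (sqr_ge0 ((peval q1 z - peval q1 x) - (peval q2 z - peval q2 x))).
  lra.
- by exists (q1 * q2); apply/funext => z; rewrite pevalM.
- have [B B1 hB] := peval_bounded q2 cK; have := h2; have := h1.
  set a := peval q1 x; exists (2 * L1 * B ^+ 2 + 2 * a ^+ 2 * L2); split=> [|z Kz].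
    by rewrite addr_ge0 // mulr_ge0 ?sqr_ge0 // mulr_ge0 ?sqr_ge0.
  have B2 : peval q2 z ^+ 2 <= B ^+ 2.
    by rewrite -real_normK ?num_real // ler_pXn2r ?nnegrE ?hB //; lra.
  have e1 := ler_pM (sqr_ge0 _) (sqr_ge0 _) (h1 _ Kz) B2.
  have e2 := ler_wpM2l (sqr_ge0 a) (h2 _ Kz).
  move: e1 e2; rewrite -/a; set b := peval q2 x; move: (peval q1 z) (peval q2 z) => u v.
  (* With uv - ab = (u - a) v + a (v - b), the square of the sum is at most twice the sum of the
     squares. *)
  have := sqr_ge0 ((u - a) * v - a * (v - b)); nra.
Qed.

Lemma peval_continuous p : continuous (peval p).
Proof.
apply: (peval_ind (Q := fun f => continuous f)) p => [a|i|f1 f2 h1 h2|f1 f2 h1 h2] x.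
- exact: cst_continuous.
- exact: coord_continuous.
- exact: (cvgD (h1 x) (h2 x)).
- exact: (cvgM (h1 x) (h2 x)).
Qed.

Definition sqdist_poly x : mpoly n R :=
  \sum_i (mpolyX R (mnm1 i) - mpolyC n (x ord0 i)) ^+ 2.

Lemma peval_sqdist x z : peval (sqdist_poly x) z = dist2 z x ^+ 2.
Proof.
rewrite /sqdist_poly peval_sum norm2_sqr; apply: eq_bigr => i _.
by rewrite pevalX pevalB peval_coord pevalC !mxE.
Qed.

End Evaluation.

(** * Degree bounds *)

Section Degree.
Context {R : realType} {n : nat}.
Implicit Types p q : mpoly n R.

Lemma deg_leW a b p : (a <= b)%N -> deg_le a p -> deg_le b p.
Proof. by move=> ab pa; apply: leq_trans pa _; rewrite ltnS. Qed.

Lemma deg_leC a c : deg_le a (mpolyC n c : mpoly n R).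
Proof. by rewrite /deg_le msizeC; case: (c != 0). Qed.

Lemma deg_le1 a : deg_le a (1 : mpoly n R).
Proof. exact: deg_leC. Qed.

Lemma deg_leD a p q : deg_le a p -> deg_le a q -> deg_le a (p + q).
Proof.
by move=> pa qa; apply: leq_trans (mmeasureD_le _ _ _) _; rewrite geq_max pa.
Qed.

Lemma deg_leN a p : deg_le a p -> deg_le a (- p).
Proof. by rewrite /deg_le mmeasureN. Qed.

Lemma deg_leB a p q : deg_le a p -> deg_le a q -> deg_le a (p - q).
Proof. by move=> pa qa; apply: deg_leD => //; exact: deg_leN. Qed.

Lemma deg_leZ a c p : deg_le a p -> deg_le a (c *: p).
Proof. exact/leq_trans/msizeZ_le. Qed.

Lemma deg_leM a b p q : deg_le a p -> deg_le b q -> deg_le (a + b) (p * q).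
Proof.
rewrite /deg_le => pa qb.
(* The formula for [msize] of a product holds for nonzero factors; a zero factor is treated
   apart. *)
have [->|p0] := eqVneq p 0; first by rewrite mul0r mmeasure0.
have [->|q0] := eqVneq q 0; first by rewrite mulr0 mmeasure0.
rewrite msizeM // -subn1 leq_subLR; apply: leq_trans (leq_add pa qb) _.
by rewrite addSn addnS add1n.
Qed.

Lemma deg_leX a k p : deg_le a p -> deg_le (k * a) (p ^+ k).
Proof.
move=> pa; elim: k => [|k IH]; first exact: deg_le1.
by rewrite exprS mulSn; exact: deg_leM.
Qed.

Lemma deg_le_logistic a i p : deg_le a p -> deg_le (2 ^ i * a) (logistic i p).
Proof.
move=> pa; elim: i => [|i IH] /=; first by rewrite mul1n.
rewrite expnS -mulnA mul2n -addnn; apply: deg_leM.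
  by rewrite -mulr_natl -[(_ * 1 * _)]mulrA mul1r mulr_natl -scaler_nat; exact: deg_leZ.
by apply: deg_leB => //; exact: deg_le1.
Qed.

(** The degree bound doubles at each iterate, and 1 + 2 + ... + 2^(r-1) = 2^r - 1. *)
Lemma deg_le_logprod a r p : deg_le a p -> deg_le ((2 ^ r - 1) * a) (logprod r p).
Proof.
move=> pa; elim: r => [|r IH]; first by rewrite /logprod big_ord0; exact: deg_le1.
have -> : ((2 ^ r.+1 - 1) * a = (2 ^ r - 1) * a + 2 ^ r * a)%N.
  by rewrite -mulnDl expnS mul2n -addnn addnBAC // expn_gt0.
rewrite logprodS; apply: deg_leM => //.
by apply: deg_leB; [exact: deg_le1|exact: deg_le_logistic].
Qed.

End Degree.

(** * Borel sets and integrals against atomic measures *)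

Section BorelSets.
Context {R : realType} {n : nat}.
Implicit Types (K : set 'rV[R]_n).

Lemma open_borel (A : set (borel R n)) : open (A : set 'rV[R]_n) -> measurable A.
Proof. by move=> oA; exact: sub_sigma_algebra. Qed.

Lemma closed_borel (A : set (borel R n)) : closed (A : set 'rV[R]_n) -> measurable A.
Proof.
by move=> cA; rewrite -[A]setCK; apply: measurableC; apply: open_borel; exact: closed_openC.
Qed.

Lemma compact_borel (A : set (borel R n)) : compact (A : set 'rV[R]_n) -> measurable A.
Proof. by move=> cA; apply: closed_borel; apply: compact_closed. Qed.

Lemma set1_borel (x : borel R n) : measurable [set x].
Proof. by apply: compact_borel; exact: compact_set1. Qed.

Lemma within_continuous_borel K (f : 'rV[R]_n -> R) : compact K ->
  {within K, continuous f} -> measurable_fun (K : set (borel R n)) f.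
Proof.
move=> cK /continuousP cf.
apply: (measurability _ (measurable_realfun.RGenOpens.measurableE R)).
move=> _ [_ [a [b ->] <-]].
have /open_subspaceP[V oV VE] := cf _ (interval_open (a := BRight a) (b := BLeft b) isT isT).
rewrite setIC -VE; apply: measurableI; last exact: compact_borel.
exact: open_borel.
Qed.

Lemma bounded_borel_integrable (m : {finite_measure set (borel R n) -> \bar R})
    K (f : 'rV[R]_n -> R) (M : R) :
  compact K -> {within K, continuous f} -> (forall x, K x -> `|f x| <= M) ->
  m.-integrable (K : set (borel R n)) (EFin \o f).
Proof.
move=> cK cf fM; apply: measurable_bounded_integrable.
- exact: compact_borel.
- by rewrite -ge0_fin_numE //; apply: fin_num_measure; exact: compact_borel.
- exact: within_continuous_borel.
- exists M; split; rewrite ?num_real // => y My x Kx /=.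
  by apply: le_trans (fM _ Kx) _; exact: ltW.
Qed.

(** Induction on [r] with [K] general: each step splits off one point and passes to [K] without it,
    until a null set remains. *)
Lemma Rintegral_atomic (m : {measure set (borel R n) -> \bar R})
    (K : set (borel R n)) (r : seq (borel R n)) (f : borel R n -> R) :
  measurable K -> m.-integrable K (EFin \o f) -> uniq r ->
  (forall x, x \in r -> K x) -> m (K `\` [set` r]) = 0%E ->
  \int[m]_(x in K) f x = \sum_(x <- r) f x * fine (m [set x]).
Proof.
elim: r K => [|x r IH] K mK fK.
  move=> _ _; rewrite big_nil set_nil setD0 => K0.
  rewrite /Rintegral null_set_integral //.
  by case/integrableP: fK.
move=> /= /andP[xr ur] rK K0; rewrite big_cons.
have Kx : K x by apply: rK; rewrite mem_head.
have KE : K = [set x] `|` (K `\` [set x]).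
  by rewrite setDUK // => _ ->.
rewrite {1}KE Rintegral_setU.
- congr (_ + _).
    rewrite (@eq_Rintegral _ _ _ m [set x] (fun=> f x) f).
      by rewrite Rintegral_cst //; exact: set1_borel.
    by move=> z; rewrite inE => ->.
  apply: IH => //.
  + by apply: measurableD => //; exact: set1_borel.
  + by apply: integrableS fK => //; apply: measurableD => //; exact: set1_borel.
  + move=> z zr; split; first by apply: rK; rewrite inE zr orbT.
    by move=> /= zx; move: xr; rewrite -zx zr.
  + rewrite setDDl -{1}K0; congr (m (_ `\` _)).
    apply/seteqP; split => z /=; rewrite inE.
      by case=> [->|->]; rewrite ?eqxx ?orbT.
    by case/orP => [/eqP ->|zr]; [left|right].
- exact: set1_borel.
- by apply: measurableD => //; exact: set1_borel.
- by rewrite -KE.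
- by apply/disj_setPS => z [/= -> []].
Qed.

End BorelSets.

(** * Integration against discrete signed measures *)

Section DiscreteMeasureIntegral.
Context {R : realType} {n : nat}.
Implicit Types (K : set 'rV[R]_n) (c : {fsfun 'rV[R]_n -> R with 0}).

Lemma discrete_measureE c (A : set (borel R n)) :
  discrete_measure c A = (\sum_(x <- finsupp c) c x * (x \in A)%:R)%:E.
Proof. by rewrite -sumEFin; apply: eq_bigr => x _; rewrite diracE EFinM. Qed.

Lemma discrete_measure_eq0 c (A : set (borel R n)) :
  (forall x, x \in finsupp c -> ~ A x) -> discrete_measure c A = 0%E.
Proof.
move=> cA; rewrite discrete_measureE big_seq big1 // => x xc.
by rewrite memNset ?mulr0 //; exact: cA.
Qed.

Lemma discrete_measure_set1 c (x : borel R n) : discrete_measure c [set x] = (c x)%:E.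
Proof.
rewrite discrete_measureE; congr EFin; have [xc|xc] := boolP (x \in finsupp c).
  rewrite (bigD1_seq x) ?fset_uniq //= big1 ?addr0 ?mem_set ?mulr1 // => z zx.
  by rewrite memNset ?mulr0 // => /= zE; move: zx; rewrite zE eqxx.
rewrite fsfun_dflt // big_seq big1 // => z zc.
by rewrite memNset ?mulr0 // => /= zE; move: xc; rewrite -zE zc.
Qed.

(** Both Jordan parts are atomic on the support of [c], and their masses at a point [x] differ by
    [c x], whichever Hahn decomposition was chosen. *)
Lemma sintegral_discrete K c (f : 'rV[R]_n -> R) :
  compact K -> (forall x, x \in finsupp c -> K x) -> {within K, continuous f} ->
  Defs.sintegral (discrete_measure c) K f = \sum_(x <- finsupp c) c x * f x.
Proof.
move=> cK cKs cf; rewrite /Defs.sintegral.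
set nu : signed_measure R n := discrete_measure c.
have nu0 (A : set (borel R n)) : (forall x, x \in finsupp c -> ~ A x) -> nu A = 0%E.
  exact: discrete_measure_eq0.
have mK : measurable (K : set (borel R n)) by exact: compact_borel.
have [M [_ hM]] := compact_bounded (continuous_compact cf cK).
have fM x : K x -> `|f x| <= M + 1.
  by move=> Kx; apply: (hM (M + 1)); [rewrite ltrDl|exists x].
have mD : measurable (K `\` [set` (finsupp c : seq (borel R n))] : set (borel R n)).
  apply: measurableD => //; apply: closed_borel.
  by apply: compact_closed => //; apply: finite_compact; exact: finite_seq.
rewrite !(@Rintegral_atomic _ _ _ _ (finsupp c)) //.
- rewrite -sumrB; apply: eq_bigr => x _; rewrite -mulrBr mulrC; congr (_ * _).
  have cxE : ((c x)%:E = jordan_pos (hahnP nu) [set x] - jordan_neg (hahnP nu) [set x])%E.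
    rewrite -discrete_measure_set1 (jordan_decomp (hahnP nu)); last exact: set1_borel.
    by rewrite /cadd /= cscaleN1.
  apply: EFin_inj; rewrite cxE EFinB !fineK //.
    exact: fin_num_measure (set1_borel x).
  exact: fin_num_measure (set1_borel x).
- exact: (bounded_borel_integrable _ cK cf fM).
- exact: fset_uniq.
(* A Jordan part is, up to sign, [nu] restricted to a Hahn set, and [nu] vanishes on every set that
   misses the support. *)
- rewrite [LHS]jordan_negE cjordan_negE /crestr0 mem_set // /crestr.
  rewrite nu0 ?oppe0 // => x xc [[_ nx] _]; exact: nx.
- exact: (bounded_borel_integrable _ cK cf fM).
- exact: fset_uniq.
- rewrite [LHS]jordan_posE cjordan_posE /crestr0 mem_set // /crestr.
  rewrite nu0 // => x xc [[_ nx] _]; exact: nx.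
Qed.

Lemma sintegral_discrete_peval K c (p : mpoly n R) :
  compact K -> (forall x, x \in finsupp c -> K x) ->
  Defs.sintegral (discrete_measure c) K (peval p) = \sum_(x <- finsupp c) c x * peval p x.
Proof.
move=> cK cs; apply: sintegral_discrete => //.
exact/continuous_subspaceT/peval_continuous.
Qed.

End DiscreteMeasureIntegral.

(** * Lagrange polynomials at finitely many points *)

Section Lagrange.
Context {R : realType} {n : nat}.
Implicit Types (x z : 'rV[R]_n) (r : seq 'rV[R]_n).

Lemma dist2_eq0 x z : dist2 x z = 0 -> x = z.
Proof.
move/eqP; rewrite /dist2 /norm2 sqrtr_eq0 => xz.
have /psumr_eq0P x0 : \sum_(i < n) (x - z) ord0 i ^+ 2 = 0.
  by apply/eqP; rewrite eq_le xz sumr_ge0 // => i _; rewrite sqr_ge0.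
apply/rowP => i; apply/eqP; rewrite -subr_eq0 -sqrf_eq0; apply/eqP.
by move: (x0 (fun i _ => sqr_ge0 _) i isT); rewrite !mxE.
Qed.

Lemma dist2xx x : dist2 x x = 0.
Proof. by rewrite /dist2 subrr /norm2 big1 ?sqrtr0 // => i _; rewrite mxE expr0n. Qed.

Lemma dist2C x z : dist2 x z = dist2 z x.
Proof. by rewrite /dist2 -norm2N opprB. Qed.

Lemma dist2_ge0 x z : 0 <= dist2 x z.
Proof. exact: norm2_ge0. Qed.

(** Squared distances as factors make this nonnegative and vanishing to second order at the nodes
    other than [x]. *)
Definition lagrange_mpoly r x : mpoly n R :=
  \prod_(x' <- r | x' != x) ((dist2 x x' ^+ 2)^-1 *: sqdist_poly x').

Lemma lagrange_id r x : peval (lagrange_mpoly r x) x = 1.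
Proof.
rewrite peval_prod big1 // => x' x'x; rewrite pevalZ peval_sqdist mulVf //.
rewrite sqrf_eq0; apply: contra x'x => /eqP /dist2_eq0 ->; exact: eqxx.
Qed.

Lemma lagrange_factor r x x' : x' \in r -> x' != x ->
  exists q, lagrange_mpoly r x = sqdist_poly x' * q.
Proof.
move=> x'r x'x; rewrite /lagrange_mpoly (big_rem x') //= x'x; eexists.
by rewrite -scalerAl scalerAr.
Qed.

Lemma lagrange_neq r x x' : x' \in r -> x' != x -> peval (lagrange_mpoly r x) x' = 0.
Proof.
move=> x'r x'x; have [q ->] := lagrange_factor x'r x'x.
by rewrite pevalM peval_sqdist dist2xx expr0n mul0r.
Qed.

End Lagrange.

(** * Total variation of discrete measures *)

Section TotalVariation.
Context {R : realType} {n : nat}.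
Implicit Types (K : set 'rV[R]_n) (c : {fsfun 'rV[R]_n -> R with 0}).

(* The test function is the Lagrange interpolant of the signs of [c], truncated
   to [-1, 1]. *)
Lemma tv_norm_discrete K c : compact K -> (forall x, x \in finsupp c -> K x) ->
  tv_norm K (discrete_measure c) = (\sum_(x <- finsupp c) `|c x|)%:E.
Proof.
move=> cK cs; apply/eqP; rewrite eq_le; apply/andP; split.
  apply: ge_ereal_sup => _ [f [cf f1] <-]; rewrite lee_fin sintegral_discrete //.
  rewrite big_seq [leRHS]big_seq; apply: ler_sum => x /cs /f1 fx1.
  by apply: le_trans (ler_norm _) _; rewrite normrM ler_piMr.
pose p := \sum_(x <- finsupp c) (Num.sg (c x)) *: lagrange_mpoly (finsupp c) x.
pose f z := 2^-1 * (`|peval p z + 1| - `|peval p z - 1|).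
have cf : {within K, continuous f}.
  apply: continuous_subspaceT => z; have cp := @peval_continuous _ _ p z.
  have c1 : continuous_at z (fun _ : 'rV[R]_n => 1 : R) by apply: cst_continuous.
  have c2 : continuous_at z (fun _ : 'rV[R]_n => 2^-1 : R) by apply: cst_continuous.
  exact: (cvgM c2 (cvgB (cvg_norm (cvgD cp c1)) (cvg_norm (cvgB cp c1)))).
apply: ereal_sup_ubound; exists f; first split => //.
- move=> z _; rewrite /f normrM gtr0_norm ?invr_gt0 //.
  have := ler_dist_dist (peval p z + 1) (peval p z - 1).
  rewrite (_ : peval p z + 1 - _ = 2); last by ring.
  rewrite [X in _ <= X -> _]gtr0_norm //; lra.
- congr EFin; rewrite sintegral_discrete //.
  rewrite big_seq [RHS]big_seq; apply: eq_bigr => x xc.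
  have -> : f x = Num.sg (c x).
    rewrite /f peval_sum (bigD1_seq x) ?fset_uniq //= big1 => [|x' x'x]; last first.
      have [x'c|x'c] := boolP (x' \in finsupp c).
        by rewrite pevalZ lagrange_neq ?mulr0 // eq_sym.
      by rewrite fsfun_dflt // sgr0 scale0r /peval meval0.
    rewrite pevalZ lagrange_id mulr1 addr0.
    case: sgrP => _.
    - by rewrite add0r sub0r normrN subrr mulr0.
    - by rewrite subrr normr0 subr0 ger0_norm //; lra.
    - by rewrite addNr normr0 sub0r ler0_norm; lra.
  by rewrite mulrC -normrEsg.
Qed.

End TotalVariation.

(** * Coefficients in an orthonormal basis *)

Section Orthonormal.
Context {R : realType} {n : nat}.

(** Parseval: the sum of the squared coefficients is the integral of the squared polynomial over
    [K], which has mass 1. *)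
Lemma orthonormal_coef_le (K : set 'rV[R]_n) (T : nat) (phi : 'I_T -> mpoly n R)
    (a : 'I_T -> R) (M : R) :
  compact K -> orthonormal_on K phi -> 0 <= M ->
  (forall z, K z -> `|peval (\sum_i a i *: phi i) z| <= M) ->
  \sum_i a i ^+ 2 <= M ^+ 2.
Proof.
move=> cK [P [PK Pphi]] M0 pM.
have mK : measurable (K : set (borel R n)) by exact: compact_borel.
have int p : P.-integrable (K : set (borel R n)) (EFin \o peval p).
  have [B _ hB] := peval_bounded p cK; apply: bounded_borel_integrable hB => //.
  exact/continuous_subspaceT/peval_continuous.
pose I p := \int[P]_(x in K) peval p x.
have ID p q : I (p + q) = I p + I q.
  rewrite /I -(RintegralD mK (int p) (int q)).
  by apply: eq_Rintegral => x _; rewrite pevalD.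
have IZ b p : I (b *: p) = b * I p.
  rewrite /I -(RintegralZl b mK (int p)).
  by apply: eq_Rintegral => x _; rewrite pevalZ.
have I0 : I 0 = 0 by have := IZ 0 0; rewrite scale0r mul0r.
have Isum (F : 'I_T -> mpoly n R) : I (\sum_i F i) = \sum_i I (F i).
  exact: (big_morph I ID I0).
have := @le_Rintegral _ _ _ P K
  (peval ((\sum_i a i *: phi i) * (\sum_i a i *: phi i))) (fun=> M ^+ 2) mK.
rewrite Rintegral_cst // (_ : fine _ = 1); last exact: (congr1 fine PK).
rewrite mulr1 -/(I _) => /(_ (int _)).
have -> : I ((\sum_i a i *: phi i) * (\sum_i a i *: phi i)) = \sum_i a i ^+ 2.
  rewrite mulr_suml Isum; apply: eq_bigr => i _.
  rewrite mulr_sumr Isum (bigD1 i) //= big1 => [|j ji].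
    rewrite addr0 -scalerAl -scalerAr !IZ /I.
    under eq_Rintegral do rewrite pevalM.
    by rewrite Pphi eqxx mulr1.
  rewrite -scalerAl -scalerAr !IZ /I.
  under eq_Rintegral do rewrite pevalM.
  by rewrite Pphi eq_sym (negbTE ji) !mulr0.
apply => [|z Kz].
  have := int (mpolyC n (M ^+ 2)); congr (_.-integrable _ _).
  by apply/funext => x /=; rewrite pevalC.
rewrite pevalM -expr2 -real_normK ?num_real // ler_pXn2r ?nnegrE //.
exact: pM.
Qed.

End Orthonormal.

(** * Consequences of feasibility and minimality *)

Section Minimizer.
Context {R : realType} {n : nat}.
Variables (K : set 'rV[R]_n) (mu Delta : {fsfun 'rV[R]_n -> R with 0}).
Variables (d T : nat) (phi : 'I_T -> mpoly n R) (delta : R) (eps : 'rV[R]_T).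
Hypotheses (cK : compact K) (muK : forall x, x \in finsupp mu -> K x)
  (DeltaK : forall x, x \in finsupp Delta -> K x) (mu0 : forall x, 0 <= mu x).
Hypotheses (phiB : basis_deg_le d phi) (phiO : orthonormal_on K phi).
Hypothesis epsd : norm2 eps <= delta.
Hypothesis Dmin : tv_minimizer K phi
  (moments K phi (discrete_measure mu) + eps) delta (discrete_measure Delta).

(** The measure [mu] is itself feasible, its residual being [- eps]. *)
Lemma minimizer_mass : \sum_(z <- finsupp Delta) `|Delta z| <= \sum_(x <- finsupp mu) mu x.
Proof.
rewrite -lee_fin -(tv_norm_discrete cK DeltaK).
have -> : (\sum_(x <- finsupp mu) mu x)%:E = tv_norm K (discrete_measure mu).
  by rewrite tv_norm_discrete //; congr EFin; apply: eq_bigr => x _; rewrite ger0_norm.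
apply: Dmin.2; split.
  move=> A _ AK; apply: discrete_measure_eq0 => x /muK Kx Ax.
  by have : (A `&` K) x by []; rewrite AK.
by rewrite opprD addrA subrr add0r norm2N.
Qed.

(** The moments of [Delta] and [mu] are compared through the noisy data: the residual of [Delta] and
    the noise [eps] each cost [delta * M] by Cauchy-Schwarz. *)
Lemma minimizer_moment (p : mpoly n R) (M : R) : 0 <= M -> deg_le d p ->
  (forall z, K z -> `|peval p z| <= M) ->
  `|\sum_(z <- finsupp Delta) Delta z * peval p z
    - \sum_(x <- finsupp mu) mu x * peval p x| <= 2 * delta * M.
Proof.
case: phiB => _ _ phiG M0 /phiG[a ->] pM.
have aM := orthonormal_coef_le cK phiO M0 pM.
have momE (c : {fsfun 'rV[R]_n -> R with 0}) : (forall x, x \in finsupp c -> K x) ->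
    \sum_(z <- finsupp c) c z * peval (\sum_i a i *: phi i) z =
    \sum_i a i * (moments K phi (discrete_measure c)) ord0 i.
  move=> cs; under eq_bigr do rewrite peval_sum mulr_sumr.
  rewrite exchange_big /=; apply: eq_bigr => i _.
  rewrite mxE sintegral_discrete_peval // mulr_sumr.
  by apply: eq_bigr => z _; rewrite pevalZ mulrCA.
rewrite !momE // -sumrB.
pose y := moments K phi (discrete_measure mu) + eps.
pose u := moments K phi (discrete_measure Delta) - y.
have -> : \sum_i (a i * (moments K phi (discrete_measure Delta)) ord0 i -
                  a i * (moments K phi (discrete_measure mu)) ord0 i) =
          \sum_i a i * u ord0 i + \sum_i a i * eps ord0 i.
  have lin (v w : 'rV[R]_T) i : a i * v ord0 i - a i * w ord0 i =
      a i * (v - (w + eps)) ord0 i + a i * eps ord0 i by rewrite !mxE; ring.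
  by rewrite -big_split; apply: eq_bigr => i _; exact: lin.
apply: le_trans (ler_normD _ _) _; rewrite -mulrA mulrDl mul1r (mulrC delta).
by apply: lerD; apply: le_trans (norm_sum_mul_le _ M0 aM) _;
  apply: ler_wpM2l => //; exact: Dmin.1.2.
Qed.

(* [1 - 2 p] has sup norm at most 1 and integral [mu(K)] against [mu], so the
   minimality of [Delta] leaves no room for mass of the wrong sign. *)
Lemma minimizer_witness (p : mpoly n R) : deg_le d p ->
  (forall z, K z -> 0 <= peval p z <= 1) ->
  (forall x, x \in finsupp mu -> peval p x = 0) ->
  \sum_(z <- finsupp Delta) (Num.max (Delta z) 0 * peval p z
    + Num.max (- Delta z) 0 * (1 - peval p z)) <= delta.
Proof.
move=> pd p01 p0.
have qd : deg_le d (1 - 2 *: p) by apply: deg_leB; [exact: deg_le1|exact: deg_leZ].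
have qE z : peval (1 - 2 *: p) z = 1 - 2 * peval p z by rewrite pevalB peval1 pevalZ.
have q1 z : K z -> `|peval (1 - 2 *: p) z| <= 1.
  by move=> Kz; rewrite qE ler_norml; move: (p01 _ Kz); move: (peval p z) => t; lra.
have := minimizer_moment ler01 qd q1; rewrite mulr1.
have -> : \sum_(x <- finsupp mu) mu x * peval (1 - 2 *: p) x = \sum_(x <- finsupp mu) mu x.
  by rewrite big_seq [RHS]big_seq; apply: eq_bigr => x xs; rewrite qE p0 // mulr0 subr0 mulr1.
rewrite ler_norml => /andP[+ _].
(* Pointwise identity by the sign of [Delta z]. The left side is at least the mass of [mu] minus
   [2 * delta], while the first sum on the right is at most that mass. *)
suff -> : \sum_(z <- finsupp Delta) Delta z * peval (1 - 2 *: p) z =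
    \sum_(z <- finsupp Delta) `|Delta z| -
    2 * \sum_(z <- finsupp Delta) (Num.max (Delta z) 0 * peval p z
    + Num.max (- Delta z) 0 * (1 - peval p z)).
  by have := minimizer_mass; lra.
rewrite mulr_sumr -sumrB; apply: eq_bigr => z _; rewrite qE.
case/orP: (le_total 0 (Delta z)) => D0.
  by rewrite ger0_norm // max_l // max_r ?oppr_le0 //; ring.
by rewrite ler0_norm // max_r // max_l ?oppr_ge0 //; ring.
Qed.

(** The witness [p = 0] leaves only the negative part. *)
Lemma minimizer_neg : \sum_(z <- finsupp Delta) Num.max (- Delta z) 0 <= delta.
Proof.
have e0 z : peval 0 z = 0 :> R by exact: meval0.
apply: le_trans (@minimizer_witness 0 _ _ _).
- by apply: ler_sum => z _; rewrite e0 mulr0 add0r subr0 mulr1.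
- by rewrite /deg_le mmeasure0.
- by move=> z _; rewrite e0 lexx ler01.
- by move=> x _; exact: e0.
Qed.

End Minimizer.

(** * Distances, diameter and nearest points *)

Section Geometry.
Context {R : realType} {n : nat}.
Implicit Types (x z : 'rV[R]_n) (r : seq 'rV[R]_n) (K : set 'rV[R]_n).

Lemma dist2_sqr_le x y z : dist2 x y ^+ 2 <= 2 * dist2 z x ^+ 2 + 2 * dist2 z y ^+ 2.
Proof.
rewrite !norm2_sqr !mulr_sumr -big_split /=; apply: ler_sum => i _; rewrite !mxE.
move: (x _ _) (y _ _) (z _ _) => a b c.
by have := sqr_ge0 ((c - a) + (c - b)); lra.
Qed.

Lemma dist2_le_diam K x y : compact K -> K x -> K y -> dist2 x y <= diam K.
Proof.
move=> cK Kx Ky; apply: ub_le_sup; last by exists x, y.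
have [M M1 hM] := peval_bounded (sqdist_poly 0) cK.
(* The squared distance is at most [4 * M], and t <= t^2 + 1. *)
exists (4 * M + 1) => _ [a [b [Ka Kb ->]]].
have := dist2_sqr_le a b 0; move: (hM _ Ka) (hM _ Kb).
rewrite !peval_sqdist !ger0_norm ?sqr_ge0 // ![dist2 _ 0]dist2C.
move: (dist2 0 a ^+ 2) (dist2 0 b ^+ 2) (dist2_ge0 a b) => u v; nra.
Qed.

Definition nearest r z x := x \in r /\ forall x', x' \in r -> dist2 z x <= dist2 z x'.

Lemma nearest_exists r z x : x \in r -> exists x', nearest r z x'.
Proof.
elim: r x => // y [|y' r] IH x _.
  by exists y; split=> [|x']; rewrite inE // => /eqP ->.
have [x' [x'r hx']] := IH y' (mem_head _ _).
have [le|/ltW le] := leP (dist2 z x') (dist2 z y).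
  exists x'; split=> [|w]; first by rewrite inE x'r orbT.
  by rewrite inE => /predU1P[->//|]; exact: hx'.
exists y; split=> [|w]; first exact: mem_head.
by rewrite inE => /predU1P[->//|/hx']; exact: le_trans.
Qed.

Lemma dist2_set_nearest r z x : nearest r z x ->
  dist2_set z [set` r] = (dist2 z x)%:E.
Proof.
move=> [xr hx]; apply/eqP; rewrite eq_le ereal_inf_lbound /=; last by exists x.
by apply/ereal_infP => _ [x' x'r <-]; rewrite lee_fin; exact: hx.
Qed.

(** If [x] is a nearest node then |x - x'|^2 <= 2 |z - x|^2 + 2 |z - x'|^2 <= 4 |z - x'|^2, so every
    factor is at least 1/4. The exponent [size r] also counts the omitted node [x]. *)
Lemma lagrange_nearest_ge r z x : nearest r z x ->
  4^-1 ^+ size r <= peval (lagrange_mpoly r x) z.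
Proof.
move=> [_ hx]; rewrite peval_prod; elim: r hx => [|x' r IH] hx.
  by rewrite big_nil expr0.
have {IH} IH := IH (fun w wr => hx w (mem_behead (s := x' :: r) wr)).
rewrite big_cons /=; case: eqP => /= [_|/eqP x'x].
  apply: le_trans IH; rewrite exprS ler_piMl ?exprn_ge0 //; lra.
rewrite exprS; apply: ler_pM => //; rewrite ?exprn_ge0 //.
rewrite pevalZ peval_sqdist.
have d0 : 0 < dist2 x x' ^+ 2.
  rewrite lt_neqAle sqr_ge0 andbT eq_sym sqrf_eq0.
  by apply: contra x'x => /eqP /dist2_eq0 ->; exact: eqxx.
rewrite ler_pdivlMl //; have := dist2_sqr_le x x' z.
have := hx _ (mem_head _ _); rewrite -(ler_pXn2r (n := 2)) ?nnegrE ?dist2_ge0 //.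
lra.
Qed.

End Geometry.

(** * Generators of the ideal and the test polynomials *)

Section IdealGenerators.
Context {R : realType} {n s : nat}.
Variables (K : set 'rV[R]_n) (r : seq 'rV[R]_n) (h : 'I_s -> mpoly n R).
Hypotheses (cK : compact K) (hI : ideal_gen h = vanishing_ideal [set` r]).

Lemma generator_vanish i x : x \in r -> peval (h i) x = 0.
Proof.
suff : vanishing_ideal [set` r] (h i) by exact.
rewrite -hI; exists (fun k => (k == i)%:R).
by rewrite (bigD1 i) //= eqxx mul1r big1 ?addr0 // => k /negbTE ->; rewrite mul0r.
Qed.

(* The polynomials [(X_j - x_j) * lagrange_mpoly r x] lie in the ideal, hence they are
   bounded on [K] by the generators; close to [x] their size is [|z_j - x_j|]. *)
Lemma generators_ge : exists2 C : R, 0 < C & forall z x, K z -> nearest r z x ->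
  C * dist2 z x ^+ 2 <= \sum_i peval (h i) z ^+ 2.
Proof.
pose u (x : 'rV[R]_n) j : mpoly n R :=
  (mpolyX R (mnm1 j) - mpolyC n (x ord0 j)) * lagrange_mpoly r x.
have uE (x : 'rV[R]_n) j z : peval (u x j) z = (z - x) ord0 j * peval (lagrange_mpoly r x) z.
  by rewrite pevalM pevalB peval_coord pevalC !mxE.
have /choice[a aE] (xj : 'rV[R]_n * 'I_n) :
    exists a : 'I_s -> mpoly n R, u xj.1 xj.2 = \sum_i a i * h i.
  suff : vanishing_ideal [set` r] (u xj.1 xj.2) by rewrite -hI.
  move=> x' /= x'r; rewrite uE; have [->|x'x] := eqVneq x' xj.1.
    by rewrite subrr mxE mul0r.
  by rewrite lagrange_neq // mulr0.
(* Summing over all nodes makes the bound on the cofactors, hence the constant, independent of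
   [x]. *)
pose A := \sum_(x <- r) \sum_j \sum_i a (x, j) i ^+ 2.
have [B B1 hB] := peval_bounded A cK.
have B0 : 0 < B by lra.
(* The numerator is the squared lower bound of [lagrange_nearest_ge]; [B] bounds the cofactors
   produced by Cauchy-Schwarz. *)
exists ((4^-1 ^+ size r) ^+ 2 / B); first by rewrite divr_gt0 // !exprn_gt0.
move=> z x Kz xn; have [xr _] := xn; rewrite mulrAC ler_pdivrMr //.
have H0 : 0 <= \sum_i peval (h i) z ^+ 2.
  by apply: sumr_ge0 => i _; rewrite sqr_ge0.
apply: le_trans (ler_wpM2l H0 (le_trans (ler_norm _) (hB _ Kz))).
apply: (@le_trans _ _ (\sum_j peval (u x j) z ^+ 2)).
  rewrite norm2_sqr mulr_sumr; apply: ler_sum => j _.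
  rewrite uE exprMn mulrC ler_wpM2l ?sqr_ge0 //.
  have k0 : 0 <= 4^-1 ^+ size r :> R by rewrite exprn_ge0.
  have := lagrange_nearest_ge xn; move: k0.
  move: (_ ^+ size r) (peval _ _) => k l k0 kl.
  by rewrite ler_pXn2r ?nnegrE // (le_trans k0).
apply: (@le_trans _ _ (\sum_j (\sum_i peval (h i) z ^+ 2) *
    (\sum_i peval (a (x, j) i) z ^+ 2))).
  apply: ler_sum => j _; rewrite (aE (x, j)) peval_sum.
  under eq_bigr do rewrite pevalM.
  by rewrite [leRHS]mulrC; exact: sum_mulr_sqr_le.
rewrite -mulr_sumr ler_wpM2l //.
have E y : peval (\sum_j \sum_i a (y, j) i ^+ 2) z =
           \sum_j \sum_i peval (a (y, j) i) z ^+ 2.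
  rewrite peval_sum; apply: eq_bigr => j _; rewrite peval_sum.
  by apply: eq_bigr => i _; rewrite pevalX.
rewrite /A peval_sum (big_rem x) //= E lerDl; apply: sumr_ge0 => y _; rewrite E.
by do 2 (apply: sumr_ge0 => ? _); rewrite sqr_ge0.
Qed.

(** One bound on the sum of squares serves all generators, since t^2 <= M and 1 <= M give t <= M for
    t >= 0. *)
Lemma generators_bounded : exists2 M : R, 1 <= M &
  forall i z, K z -> `|peval (h i) z| <= M.
Proof.
have [M M1 hM] := peval_bounded (\sum_i h i ^+ 2) cK.
exists M => // i z Kz; have := hM z Kz; rewrite peval_sum => /(le_trans (ler_norm _)).
rewrite (bigD1 i) //= pevalX -[peval (h i) z ^+ 2]real_normK ?num_real //.
set S := \sum_(k < s | _) _.
have S0 : 0 <= S by apply: sumr_ge0 => k _; rewrite pevalX sqr_ge0.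
move: (normr_ge0 (peval (h i) z)); move: (`|_|) => t; nra.
Qed.

Lemma test_polynomials (g : nat) : (forall i, deg_le g (h i)) ->
  exists2 C : R, 0 < C & forall m : nat, (1 < m)%N ->
  exists p : 'I_s -> mpoly n R,
    [/\ forall i, deg_le (2 * (m - 1) * g) (p i),
        forall i z, K z -> 0 <= peval (p i) z <= 1,
        forall i x, x \in r -> peval (p i) x = 0 &
        forall z x, K z -> nearest r z x ->
          Num.min (1 / 2) (m%:R ^+ 2 * C * dist2 z x ^+ 2) <= \sum_i peval (p i) z].
Proof.
move=> hg; have [C C0 hC] := generators_ge; have [M M1 hM] := generators_bounded.
have M0 : 0 < M by lra.
(* The factor 32 is 16 * 2: 16 from m < 2^(l+2), which gives m^2 / 16 <= 4^l, and 2 from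
   [one_sub_logprod_ge]. The factor [M ^+ 2] normalises the generators to absolute value at most
   1. *)
exists (C / (32 * M ^+ 2)); first by rewrite divr_gt0 // mulr_gt0 // exprn_gt0.
move=> m m1; pose k := trunc_log 2 m.
have /andP[km mk] : (2 ^ k <= m < 2 ^ k.+1)%N by apply: trunc_log_bounds => //; exact: ltnW.
(* Since m > 1, the exponent [k] is positive, as the index in [one_sub_logprod_ge] requires. *)
have [l kE] : exists l, k = l.+1.
  by exists k.-1; rewrite prednK // trunc_log_gt0.
pose w i z : R := (M^-1 * peval (h i) z) ^+ 2.
exists (fun i => 1 - logprod k ((M^-1 *: h i) ^+ 2)).
have pE i z : peval (1 - logprod k ((M^-1 *: h i) ^+ 2)) z = 1 - logprod k (w i z).
  rewrite pevalB peval1 {1}/peval (rmorph_logprod (meval (z ord0))).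
  by rewrite rmorphXn /= mevalZ.
have w01 i z : K z -> 0 <= w i z <= 1.
  move=> Kz; rewrite /w sqr_ge0 /= -real_normK ?num_real // exprn_ile1 //.
  by rewrite normrM ger0_norm ?invr_ge0 ?(ltW M0) // ler_pdivrMl // mulr1 hM.
split=> [i|i z Kz|i x xr|z x Kz xn].
- apply: deg_leB; first exact: deg_le1.
  apply: (@deg_leW _ _ ((2 ^ k - 1) * (2 * g))).
    by rewrite mulnA [X in (_ <= X * _)%N]mulnC leq_mul // leq_mul // leq_sub2r.
  by apply: deg_le_logprod; apply: deg_leX; apply: deg_leZ.
- by rewrite pE; have := logprod_itv k (w01 i z Kz); lra.
- by rewrite pE /w generator_vanish // mulr0 expr0n logprod0 subrr.
have mlk : m%:R ^+ 2 / 16 <= 4 ^+ l :> R.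
  rewrite ler_pdivrMr // (_ : _ * 16 = (2 ^+ k.+1) ^+ 2); last first.
    by rewrite kE -exprM mulnC exprM (_ : 2 ^+ 2 = 4) ?exprSr; ring.
  by rewrite ler_pXn2r ?nnegrE ?ler0n ?exprn_ge0 // -natrX ler_nat ltnW.
have pge i : Num.min (1 / 2) (m%:R ^+ 2 * w i z / 32) <= 1 - logprod k (w i z).
  rewrite kE; apply: le_trans (one_sub_logprod_ge l (w01 i z Kz)).
  rewrite le_min ge_min lexx /= ge_min; apply/orP; right.
  have /andP[w0 _] := w01 i z Kz; nra.
under eq_bigr do rewrite pE.
have p0 i : 0 <= 1 - logprod k (w i z) by have := logprod_itv k (w01 i z Kz); lra.
(* Either one summand already reaches 1/2, or every minimum in [pge] is bounded through its
   quadratic term and these terms can be added. *)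
rewrite ge_min; have [[i hi]|hn] := pselect (exists i, 1 / 2 <= 1 - logprod k (w i z)).
  apply/orP; left; rewrite (bigD1 i) //=; apply: le_trans hi _.
  by rewrite lerDl sumr_ge0.
apply/orP; right.
apply: (@le_trans _ _ (\sum_i m%:R ^+ 2 * w i z / 32)); last first.
  apply: ler_sum => i _; have := pge i; rewrite ge_min => /orP[hi|//].
  by exfalso; apply: hn; exists i.
rewrite -mulr_suml -mulr_sumr (_ : \sum_i w i z = (M ^+ 2)^-1 * \sum_i peval (h i) z ^+ 2).
  have := hC z x Kz xn; set S := \sum_i _ => CS.
  have c0 : 0 <= m%:R ^+ 2 / (32 * M ^+ 2) by rewrite divr_ge0 ?sqr_ge0 // mulr_ge0 ?sqr_ge0.
  have := ler_wpM2l c0 CS; move: (dist2 z x ^+ 2) => D2.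
  rewrite [X in X <= _ -> _](_ : _ = m%:R ^+ 2 * (C / (32 * M ^+ 2)) * D2); last by ring.
  by rewrite (_ : _ * S = m%:R ^+ 2 * ((M ^+ 2)^-1 * S) / 32) // invfM; ring.
by rewrite mulr_sumr; apply: eq_bigr => i _; rewrite /w exprMn exprVn.
Qed.

(** The product [F] of the linear forms X_j - y_j over the nodes is a nonzero element of the ideal,
    so some generator is nonzero; as it vanishes at [x], it is not constant. *)
Lemma generator_deg_gt0 (g : nat) (x : 'rV[R]_n) (j : 'I_n) :
  (forall i, deg_le g (h i)) -> x \in r -> (0 < s)%N /\ (0 < g)%N.
Proof.
move=> hg xr.
pose F : mpoly n R := \prod_(y <- r) (mpolyX R (mnm1 j) - mpolyC n (y ord0 j)).
have F0 : F != 0.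
  rewrite prodf_seq_neq0; apply/allP => y _ /=; apply/negP => /eqP y0.
  (* A factor is nonzero because its value at the node shifted by 1 in each coordinate is 1. *)
  have := congr1 (peval^~ (\row_k (y ord0 k + 1))) y0.
  rewrite /= pevalB peval_coord pevalC mxE /peval meval0 addrAC subrr add0r => /eqP.
  by rewrite oner_eq0.
have [a Fa] : ideal_gen h F.
  rewrite hI => y /= yr; rewrite peval_prod (big_rem y) //=.
  by rewrite pevalB peval_coord pevalC subrr mul0r.
have [i hi] : exists i, h i != 0.
  apply: contrapT => hn; move/eqP: F0; apply; rewrite Fa big1 // => i _.
  have [->|hi] := eqVneq (h i) 0; first by rewrite mulr0.
  by exfalso; apply: hn; exists i.
split; first by apply: leq_ltn_trans (ltn_ord i).
rewrite lt0n; apply/negP => /eqP g0; move: (hg i); rewrite g0 => /msize1_polyC hE.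
move: (generator_vanish i xr); rewrite hE [peval _ _]pevalC => c0.
by move: hi; rewrite hE c0 => /eqP; apply; rewrite /mpolyC; exact: mpolyC0.
Qed.

End IdealGenerators.

(** * Bump polynomials at the points of X *)

Lemma seq_uniform_bound (R : realType) (T : eqType) (r : seq T) (P : T -> R -> Prop) :
  (forall x B B', B <= B' -> P x B -> P x B') ->
  (forall x, x \in r -> exists B, P x B) ->
  exists2 B, 1 <= B & forall x, x \in r -> P x B.
Proof.
move=> Pmono; elim: r => [|x r IH] Pr; first by exists 1.
have [B B1 PB] := IH (fun y yr => Pr y (mem_behead (s := x :: r) yr)).
have [B' PB'] := Pr x (mem_head _ _).
exists (Num.max B B') => [|y]; first by rewrite le_max B1.
rewrite inE => /predU1P[->|/PB Py].
  by apply: Pmono PB'; rewrite le_max lexx orbT.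
by apply: Pmono Py; rewrite le_max lexx.
Qed.

Section Bump.
Context {R : realType} {n : nat}.
Implicit Types (K : set 'rV[R]_n) (r : seq 'rV[R]_n) (x z : 'rV[R]_n).

(* [q = 1 - (1 - l)^2 = l (2 - l)] for the Lagrange polynomial [l] at [x]: both
   [1 - q] at [x] and [q] at the other nodes vanish to second order. *)
Lemma bump_polynomials K r : compact K -> exists2 L : R, 1 <= L &
  forall x, x \in r -> exists q : mpoly n R,
    [/\ (msize q)%:R <= L, forall z, K z -> `|peval q z| <= L,
        forall z, K z -> `|1 - peval q z| <= L * dist2 z x ^+ 2 &
        forall x', x' \in r -> x' != x -> forall z, K z ->
          `|peval q z| <= L * dist2 z x' ^+ 2].
Proof.
move=> cK; apply: seq_uniform_bound => [x B B' BB' [q [q1 q2 q3 q4]]|x xr].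
  exists q; split=> [|z Kz|z Kz|x' x'r x'x z Kz].
  - exact: le_trans BB'.
  - exact: le_trans (q2 _ Kz) BB'.
  - by apply: le_trans (q3 _ Kz) _; rewrite ler_wpM2r ?sqr_ge0.
  - by apply: le_trans (q4 _ x'r x'x _ Kz) _; rewrite ler_wpM2r ?sqr_ge0.
pose l := lagrange_mpoly r x; pose q := l * (2%:R%:A - l).
have qE z : peval q z = peval l z * (2 - peval l z).
  by rewrite pevalM pevalB pevalZ peval1 mulr1.
have [B2 _ hB2] := peval_bounded q cK.
have [B3 B30 hB3] := peval_lipschitz x l cK.
have [B4 _ hB4] : exists2 B, 1 <= B & forall x', x' \in r -> x' != x ->
    forall z, K z -> `|peval q z| <= B * dist2 z x' ^+ 2.
  apply: seq_uniform_bound => [x' B B' BB' hB x'x z Kz|x' x'r].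
    by apply: le_trans (hB x'x _ Kz) _; rewrite ler_wpM2r ?sqr_ge0.
  have [->|x'x] := eqVneq x' x; first by exists 0.
  have [t lt] := lagrange_factor x'r x'x.
  have [B _ hB] := peval_bounded (t * (2%:R%:A - l)) cK.
  (* The squared distance to another node factors out of [q], and the cofactor is bounded on [K]. *)
  have -> : q = sqdist_poly x' * (t * (2%:R%:A - l)) by rewrite mulrA -lt.
  exists B => _ z Kz; rewrite pevalM peval_sqdist normrM.
  by rewrite ger0_norm ?sqr_ge0 // mulrC ler_wpM2r ?sqr_ge0 //; exact: hB.
(* With [msize q] in the maximum, every m >= L is large enough for the degree of the bump. *)
exists (Num.max (msize q)%:R (Num.max B2 (Num.max B3 B4))), q.
split=> [|z Kz|z Kz|x' x'r x'x z Kz].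
- by rewrite !le_max lexx.
- by rewrite !le_max hB2 // !orbT.
- apply: (@le_trans _ _ (B3 * dist2 z x ^+ 2)).
    have := hB3 _ Kz; rewrite lagrange_id qE.
    by rewrite (_ : 1 - _ = (peval l z - 1) ^+ 2) ?ger0_norm ?sqr_ge0 //; ring.
  by rewrite ler_wpM2r ?sqr_ge0 // !le_max lexx !orbT.
- apply: le_trans (hB4 _ x'r x'x _ Kz) _.
  by rewrite ler_wpM2r ?sqr_ge0 // !le_max lexx !orbT.
Qed.

End Bump.

(** * Estimates on the masses of the minimizer *)

(** Turns the sums of the theorem, indexed by possibly infinite sets of points, into sums over the
    support of [Delta]. *)
Lemma fsbig_finsupp (T : choiceType) (V : eqType) (v0 : V) (c : {fsfun T -> V with v0})
    (W : Type) (idx : W) (op : Monoid.com_law idx) (A : set T) (F : T -> W) :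
  (forall z, z \notin finsupp c -> F z = idx) ->
  \big[op/idx]_(z \in A) F z =
  \big[op/idx]_(z <- finsupp c) (if z \in A then F z else idx).
Proof.
move=> F0; rewrite fsbig_mkcond -(fsbig_widen [set` finsupp c] setT) //.
  by rewrite -fsbig_seq ?fset_uniq //; apply: eq_bigr => z _; rewrite patchE.
move=> z [_ /= zc]; rewrite /preimage /=. rewrite /patch F0 ?if_same //; exact/negP.
Qed.

Section Recovery.
Context {R : realType} {n : nat}.
Variables (K : set 'rV[R]_n) (r : seq 'rV[R]_n) (mu Delta : {fsfun 'rV[R]_n -> R with 0}).
Variables (d T : nat) (phi : 'I_T -> mpoly n R) (delta : R) (eps : 'rV[R]_T).
Hypotheses (cK : compact K) (rK : forall x, x \in r -> K x)
  (mur : forall x, x \in finsupp mu -> x \in r)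
  (DeltaK : forall x, x \in finsupp Delta -> K x) (mu0 : forall x, 0 <= mu x).
Hypotheses (phiB : basis_deg_le d phi) (phiO : orthonormal_on K phi).
Hypothesis epsd : norm2 eps <= delta.
Hypothesis Dmin : tv_minimizer K phi
  (moments K phi (discrete_measure mu) + eps) delta (discrete_measure Delta).

Let muK x : x \in finsupp mu -> K x. Proof. by move=> /mur /rK. Qed.

(** Adds the [s] inequalities of [minimizer_witness] after dropping their nonnegative terms in the
    negative part of [Delta]. *)
Lemma sum_witness_le (s : nat) (p : 'I_s -> mpoly n R) :
  (forall i, deg_le d (p i)) -> (forall i z, K z -> 0 <= peval (p i) z <= 1) ->
  (forall i x, x \in r -> peval (p i) x = 0) ->
  \sum_(z <- finsupp Delta) Num.max (Delta z) 0 * \sum_i peval (p i) z <= s%:R * delta.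
Proof.
move=> pd p01 p0; under eq_bigr do rewrite mulr_sumr.
rewrite exchange_big /= mulr_natl -[X in _ <= _ *+ X](card_ord s) -sumr_const.
apply: ler_sum => i _.
apply: le_trans (minimizer_witness cK muK DeltaK mu0 phiB phiO epsd Dmin (pd i) (p01 i) _).
  rewrite big_seq [leRHS]big_seq; apply: ler_sum => z /DeltaK Kz.
  by rewrite lerDl mulr_ge0 ?le_max ?lexx ?orbT // subr_ge0; case/andP: (p01 i _ Kz).
by move=> x /mur; exact: p0.
Qed.

(** The bump [q] is 1 at [x] and 0 at the other nodes, so its integral against [mu] is [mu x];
    against [Delta] it replaces the indicator of the ball around [x]. Here [f] bounds the positive
    mass far from all nodes, and in [3 * L + 1] the moment error contributes [2 * L] and the
    negative part [L + 1]. *)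
Lemma local_mass_error (x : 'rV[R]_n) (q : mpoly n R) (L c0 b f : R) :
  x \in r -> 1 <= L -> 0 <= c0 -> deg_le d q ->
  (forall z, K z -> `|peval q z| <= L) ->
  (forall z, K z -> `|1 - peval q z| <= L * dist2 z x ^+ 2) ->
  (forall x', x' \in r -> x' != x -> forall z, K z ->
    `|peval q z| <= L * dist2 z x' ^+ 2) ->
  L * c0 ^+ 2 <= b ->
  \sum_(z <- finsupp Delta)
    (if all (fun x' => c0 < dist2 z x') r then Num.max (Delta z) 0 else 0)
    <= f ->
  `|mu x - \sum_(z <- finsupp Delta) (if dist2 z x <= c0 then Delta z else 0)|
    <= b * (\sum_(x <- finsupp mu) mu x) + (L * f + (3 * L + 1) * delta).
Proof.
move=> xr L1 c00 qd qL q1 q0 Lb hf.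
have qmu : \sum_(y <- finsupp mu) mu y * peval q y = mu x.
  have q0' y : y \in r -> y != x -> peval q y = 0.
    move=> yr yx; apply/eqP; rewrite -normr_le0; apply: le_trans (q0 _ yr yx _ (rK yr)) _.
    by rewrite dist2xx expr0n mulr0.
  have q1' : peval q x = 1.
    apply/eqP; rewrite eq_sym -subr_eq0 -normr_le0; apply: le_trans (q1 _ (rK xr)) _.
    by rewrite dist2xx expr0n mulr0.
  have [xm|xm] := boolP (x \in finsupp mu).
    rewrite (bigD1_seq x) ?fset_uniq //= q1' mulr1 big_seq_cond big1 ?addr0 //.
    by move=> y /andP[/mur yr yx]; rewrite q0' ?mulr0.
  rewrite fsfun_dflt // big_seq big1 // => y ym.
  by rewrite q0' ?mulr0 ?mur //; apply: contraNneq xm => <-.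
have L0 : 0 <= L by lra.
have := minimizer_moment cK muK DeltaK phiB phiO epsd Dmin L0 qd qL; rewrite qmu => hq.
set S := \sum_(z <- _) (if _ then _ else _).
set M := \sum_(y <- finsupp mu) mu y.
suff : `|\sum_(z <- finsupp Delta) Delta z * peval q z - S| <=
       b * M + (L * f + (L + 1) * delta).
  move: hq; set Q := \sum_(z <- _) _ * _; rewrite !ler_norml; lra.
have b0 : 0 <= b by apply: le_trans Lb; rewrite mulr_ge0 ?sqr_ge0.
pose far z := all (fun x' => c0 < dist2 z x') r.
rewrite -sumrB; apply: le_trans (ler_norm_sum _ _ _) _.
apply: (@le_trans _ _ (\sum_(z <- finsupp Delta)
  (b * Num.max (Delta z) 0 + L * (if far z then Num.max (Delta z) 0 else 0)
   + (L + 1) * Num.max (- Delta z) 0))).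
  rewrite big_seq [leRHS]big_seq; apply: ler_sum => z /DeltaK Kz.
  pose e : R := peval q z - (dist2 z x <= c0)%R%:R.
  have -> : Delta z * peval q z - (if dist2 z x <= c0 then Delta z else 0) = Delta z * e.
    by rewrite /e; case: ifP => _; rewrite /=; ring.
  have eL : `|e| <= L + 1.
    apply: le_trans (ler_normB _ _) _; apply: lerD; first exact: qL.
    by case: (dist2 z x <= c0); rewrite ?normr1 ?normr0.
  (* Three cases: in the ball of [x] the error is |1 - q|, near another node it is |q|, both at most
     L c0^2; far from all nodes only |q| <= L is available. *)
  have eb : `|e| <= b + (if far z then L else 0).
    rewrite /e; have [zx|zx] := boolP (dist2 z x <= c0).
      rewrite distrC; apply: le_trans (q1 _ Kz) _.
      apply: (@le_trans _ _ b); last by rewrite lerDl; case: ifP.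
      by apply: le_trans Lb; rewrite ler_wpM2l // ler_pXn2r ?nnegrE ?dist2_ge0.
    rewrite subr0; case: ifP => [_|/negbT /allPn[x' x'r]].
      by apply: le_trans (qL _ Kz) _; rewrite lerDr.
    rewrite -leNgt => zx'.
    rewrite addr0; apply: le_trans (q0 x' x'r _ _ Kz) _.
      by apply: contraNneq zx => <-.
    by apply: le_trans Lb; rewrite ler_wpM2l // ler_pXn2r ?nnegrE ?dist2_ge0.
  rewrite normrM; case/orP: (le_total 0 (Delta z)) => D0.
    rewrite ger0_norm // max_l // max_r ?oppr_le0 // mulr0 addr0 mulrC.
    by apply: le_trans (ler_wpM2r D0 eb) _; rewrite mulrDl; case: (far z); lra.
  rewrite ler0_norm // max_r // max_l ?oppr_ge0 // if_same !mulr0 !add0r mulrC.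
  by rewrite ler_wpM2r ?oppr_ge0.
rewrite !big_split /= -!mulr_sumr -addrA.
apply: lerD.
  apply: ler_wpM2l => //; apply: le_trans (minimizer_mass cK muK DeltaK mu0 epsd Dmin).
  by apply: ler_sum => z _; rewrite ge_max ler_norm normr_ge0.
apply: lerD; first exact: ler_wpM2l.
apply: ler_wpM2l; first lra.
exact: (minimizer_neg cK muK DeltaK mu0 phiB phiO epsd Dmin).
Qed.

End Recovery.

(** * Choice of the constants and proof of the three items *)

Theorem theorem1p4 (R : realType) (n : nat) (K X : set 'rV[R]_n)
    (mu : {fsfun 'rV[R]_n -> R with 0})
    (s g : nat) (h : 'I_s -> mpoly n R) :
  compact K -> X `<=` K -> finite_set X ->
  (forall x, 0 <= mu x) -> (forall x, x \in finsupp mu -> X x) ->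
  ideal_gen h = vanishing_ideal X -> (forall i, deg_le g (h i)) ->
  exists2 D : R, 0 < D &
  exists m0 : nat, forall m : nat, (m0 <= m)%N -> ~~ odd m ->
  forall (d T : nat) (phi : 'I_T -> mpoly n R) (delta : R) (eps : 'rV[R]_T)
    (Delta : {fsfun 'rV[R]_n -> R with 0}),
  (2 * (m - 1) * g <= d)%N ->
  basis_deg_le d phi -> orthonormal_on K phi ->
  0 <= delta -> norm2 eps <= delta ->
  let y := moments K phi (discrete_measure mu) + eps in
  (forall x, x \in finsupp Delta -> K x) ->
  tv_minimizer K phi y delta (discrete_measure Delta) ->
  let c0 := m%:R^-1 * Num.sqrt (3`!%:R / D) in
  [/\ forall z, K z -> 4 * s%:R * delta < Delta z ->
        (dist2_set z X <= c0%:E)%E,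
      [/\ (\sum_(z \in [set z | near_set K X c0 z /\ (0 < Delta z)%R])
             (Delta z)%:E * dist2_set z X ^+ 2
           <= (3`!%:R * (4 * s%:R) / (m%:R ^+ 2 * D) * delta)%:E)%E,
          \sum_(z \in [set z | far_set K X c0 z /\ 0 < Delta z]) Delta z
            <= 2 * s%:R * delta &
          \sum_(z \in [set z | Delta z < 0]) `|Delta z| <= 2 * delta] &
      forall x, X x ->
        (`|mu x - \sum_(z \in [set z | K z /\ dist2 z x <= c0]) Delta z|%:E
         <= (m%:R^-1)%:E * tv_norm K (discrete_measure mu)
            + ((2 * (s%:R + 1)
                + 3`!%:R * 2 * s%:R * pi ^+ 2 / (diam K ^+ 2 * D))
               * delta)%:E)%E].
Proof.
move=> cK XK /finite_seqP[r XE] mu0; rewrite {}XE in XK * => mur hI hg.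
have rK x : x \in r -> K x by exact: XK.
have [C C0 hC] := test_polynomials cK hI hg.
have [L L1 hL] := bump_polynomials r cK.
(* The coefficient of [delta] in [local_mass_error] when the far mass is bounded by
   [2 * s%:R * delta]. *)
pose kap : R := 3 * L + 1 + 2 * L * s%:R.
have kap0 : 0 < kap.
  have : 0 <= L * s%:R by rewrite mulr_ge0 //; lra.
  by rewrite /kap; lra.
have fact3 : 3`!%:R = 6 :> R by [].
(* The bound [12 * C] serves the growth estimate, and a small [D] lets the diameter term absorb
   [kap]. The latter needs a positive diameter, hence the point [z != x]; when [K] is a single point
   the quotient by the zero diameter is 0 by convention. *)
have [D D0 [DC DK]] : exists2 D : R, 0 < D & D <= 12 * C /\
    forall x z, x \in r -> K z -> z != x ->
      (0 < g)%N /\ kap <= 6 * 2 * s%:R * pi ^+ 2 / (diam K ^+ 2 * D).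
  have [[x [z [xr Kz zx]]]|noz] := pselect (exists x z, [/\ x \in r, K z & z != x]);
      last first.
    exists (12 * C); first lra.
    by split=> // x z xr Kz zx; exfalso; apply: noz; exists x, z.
  have [j _] : exists j, z ord0 j != x ord0 j.
    by apply/existsP; rewrite -negb_forall; apply: contra zx => /forallP le_h;
      apply/eqP/rowP => j; exact/eqP.
  have [s0 g0] := generator_deg_gt0 hI j hg xr.
  have diam0 : 0 < diam K.
    apply: lt_le_trans (dist2_le_diam cK Kz (rK _ xr)).
    by rewrite lt_neqAle dist2_ge0 andbT eq_sym; apply: contra zx => /eqP /dist2_eq0 ->.
  have a0 : 0 < 6 * 2 * s%:R * pi ^+ 2 / diam K ^+ 2 :> R.
    by rewrite divr_gt0 ?exprn_gt0 // mulr_gt0 ?exprn_gt0 ?pi_gt0 // mulr_gt0 // ltr0n.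
  exists (Num.min (12 * C) (6 * 2 * s%:R * pi ^+ 2 / diam K ^+ 2 / kap)).
    by rewrite lt_min mulr_gt0 //= divr_gt0.
  split=> [|_ _ _ _ _]; first by rewrite ge_min lexx.
  split=> //; rewrite invfM mulrA ler_pdivlMr; last by rewrite lt_min mulr_gt0 //= divr_gt0.
  by rewrite mulrC -ler_pdivlMr // ge_min lexx orbT.
(* The summand 6 L / D ensures L c0^2 <= 1 / m, the summand [L] bounds the size of the bump by m,
   and 2 is what [test_polynomials] requires. *)
exists D => //; exists (maxn 2 (Num.bound (6 * L / D + L))) => m.
rewrite geq_max => /andP[m2 mB] _ d T phi delta eps Delta dm phiB phiO d0 epsd y.
move=> DeltaK Dmin c0.
have m0 : 0 < m%:R :> R by rewrite ltr0n ltnW.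
have c00 : 0 <= c0 by rewrite mulr_ge0 ?invr_ge0 ?sqrtr_ge0 ?ltW.
have c02 : c0 ^+ 2 = 6 / (m%:R ^+ 2 * D).
  rewrite /c0 fact3 exprMn sqr_sqrtr ?divr_ge0 ?ltW // exprVn.
  by rewrite [in RHS]invfM; ring.
have mL : 6 * L / D + L <= m%:R.
  have h0 : 0 <= 6 * L / D + L by rewrite addr_ge0 ?divr_ge0 ?mulr_ge0 ?ltW //; lra.
  by apply/ltW/(lt_le_trans (archi_boundP h0)); rewrite ler_nat.
have s0 : 0 <= s%:R * delta by rewrite mulr_ge0.
(* If X is empty there is no nearest point; then [mu] is zero, and so is [Delta] by
   [minimizer_mass]. *)
have [r0|[x0 x0r]] : (forall x, x \notin r) \/ exists x, x \in r.
  case: (r) => [|x r']; [by left|right; exists x; exact: mem_head].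
  have muE : \sum_(x <- finsupp mu) mu x = 0.
    by rewrite big_seq big1 // => x /mur; rewrite /= (negbTE (r0 x)).
  have Delta0 z : Delta z = 0.
    have [zD|/fsfun_dflt //] := boolP (z \in finsupp Delta).
    have := minimizer_mass cK (fun x xm => rK x (mur x xm)) DeltaK mu0 epsd Dmin.
    rewrite muE (bigD1_seq z) ?fset_uniq //= => le_h; apply/eqP; rewrite -normr_le0.
    by apply: le_trans le_h; rewrite lerDl sumr_ge0.
  split=> [z _||x /=]; last by rewrite (negbTE (r0 x)).
    by rewrite Delta0 -mulrA ltNge mulr_ge0.
  split.
  - rewrite fsbig1 => [|z [_]]; last by rewrite Delta0 ltxx.
    by rewrite lee_fin fact3 mulr_ge0 // divr_ge0 ?mulr_ge0 ?sqr_ge0 ?(ltW D0).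
  - by rewrite fsbig1 => [|z [_]]; [rewrite -mulrA mulr_ge0|rewrite Delta0 ltxx].
  - by rewrite fsbig1 => [|z]; [rewrite mulr_ge0|rewrite /= Delta0 ltxx].
have [p [pd p01 p0 pF]] := hC m m2.
have W := sum_witness_le cK rK mur DeltaK mu0 phiB phiO epsd Dmin
  (fun i => deg_leW dm (pd i)) p01 p0.
pose F z : R := \sum_i peval (p i) z.
have F0 z : K z -> 0 <= F z by move=> Kz; apply: sumr_ge0 => i _; case/andP: (p01 i z Kz).
pose P z : R := Num.max (Delta z) 0.
have P0 z : 0 <= P z by rewrite le_max lexx orbT.
have nearE z : exists2 x, nearest r z x & dist2_set z [set` r] = (dist2 z x)%:E.
  have [x xn] := nearest_exists z x0r; exists x => //; exact: dist2_set_nearest.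
have mD0 : 0 < m%:R ^+ 2 * D by rewrite mulr_gt0 ?exprn_gt0.
have c02E : m%:R ^+ 2 * D * c0 ^+ 2 = 6 by rewrite c02 mulrC divfK // gt_eqF.
(* As m^2 D c0^2 = 6, the two terms of the minimum agree exactly at distance [c0]. *)
have growth z x : K z -> nearest r z x ->
    Num.min (1 / 2) (m%:R ^+ 2 * D * dist2 z x ^+ 2 / 12) <= F z.
  move=> Kz xn; apply: le_trans (pF z x Kz xn); rewrite le_min ge_min lexx /=.
  have e0 : 0 <= m%:R ^+ 2 * dist2 z x ^+ 2 / 12
    by rewrite divr_ge0 ?mulr_ge0 ?dist2_ge0 ?ler0n.
  by rewrite ge_min; apply/orP; right; have := ler_wpM2l e0 DC; lra.
(* At distance at least [c0] the sum [F] is at least 1/2, so the positive mass there is at most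
   twice the bound [W]. The predicate [Q] will be a single point, the far set, and the complement of
   the closed balls of radius [c0]. *)
have far_sum (Q : 'rV[R]_n -> bool) :
    (forall z, K z -> Q z -> forall x, nearest r z x -> c0 <= dist2 z x) ->
    \sum_(z <- finsupp Delta) (if Q z then P z else 0) <= 2 * s%:R * delta.
  move=> Qfar; rewrite -mulrA -ler_pdivrMl //; apply: le_trans W.
  rewrite mulr_sumr big_seq [leRHS]big_seq; apply: ler_sum => z /DeltaK Kz.
  case: ifP => [Qz|_]; last by rewrite mulr0 mulr_ge0 ?P0 ?F0.
  rewrite mulrC ler_wpM2l ?P0 //; have [x xn _] := nearE z.
  apply: le_trans (growth z x Kz xn); rewrite le_min; apply/andP; split; first lra.
  have : c0 ^+ 2 <= dist2 z x ^+ 2.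
    by rewrite ler_pXn2r ?nnegrE ?dist2_ge0 //; exact: Qfar Kz Qz _ xn.
  rewrite -(ler_pM2l mD0) c02E; lra.
have finP z : 0 < Delta z -> z \in finsupp Delta.
  by rewrite mem_finsupp => /gt_eqF ->.
split.
- move=> z Kz Dz; have [x xn ->] := nearE z; rewrite lee_fin leNgt; apply/negP => zfar.
  have Dz0 : 0 < Delta z by apply: le_lt_trans Dz; rewrite -mulrA mulr_ge0.
  have := far_sum (pred1 z); rewrite (bigD1_seq z) ?fset_uniq ?finP //= eqxx.
  rewrite big1 => [|w /negbTE -> //]; rewrite addr0 /P (max_l (ltW Dz0)) => le_h.
  have : Delta z <= 2 * s%:R * delta.
    apply: le_h => w _ /eqP -> x' [x'r _]; apply: ltW; apply: lt_le_trans zfar _.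
    by case: xn => _; exact.
  lra.
- split.
  + rewrite (fsbig_finsupp (c := Delta)) => [|z zD]; last first.
      by rewrite fsfun_dflt // mul0e.
    apply: (@le_trans _ _ (\sum_(z <- finsupp Delta)
        24 / (m%:R ^+ 2 * D) * (P z * F z))%:E).
      rewrite -sumEFin big_seq [leRHS]big_seq; apply: lee_sum => z /DeltaK Kz.
      have [x xn xE] := nearE z.
      case: ifPn => [|_]; last first.
        by rewrite lee_fin mulr_ge0 ?divr_ge0 ?mulr_ge0 ?P0 ?F0 ?ltW.
      rewrite inE /near_set /= xE lee_fin => -[[_ zx] Dz].
      rewrite -!EFinM -expr2 lee_fin /P (max_l (ltW Dz)) [leRHS]mulrCA ler_wpM2l ?(ltW Dz) //.
      have hF := growth z x Kz xn.
      have le6 : m%:R ^+ 2 * D * dist2 z x ^+ 2 <= 6.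
        by rewrite -c02E ler_pM2l // ler_pXn2r ?nnegrE ?dist2_ge0.
      rewrite mulrAC ler_pdivlMr // mulrC.
      (* Within distance [c0] the left side is at most 6 / 24, below 1/2, so the quadratic term
         governs; 24 is 3! * 4. *)
      have : m%:R ^+ 2 * D * dist2 z x ^+ 2 / 24 <= F z.
        apply: le_trans hF; rewrite le_min; apply/andP; split; first lra.
        have : 0 <= m%:R ^+ 2 * D * dist2 z x ^+ 2 by rewrite mulr_ge0 ?sqr_ge0 ?ltW.
        lra.
      lra.
    rewrite lee_fin -mulr_sumr fact3.
    rewrite (_ : 6 * (4 * s%:R) / _ * delta = 24 / (m%:R ^+ 2 * D) * (s%:R * delta)).
      by rewrite ler_wpM2l // divr_ge0 ?ltW.
    ring.
  + rewrite (fsbig_finsupp (c := Delta)) => [|z zD]; last by rewrite fsfun_dflt.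
    apply: le_trans (far_sum
      (fun z => z \in [set z | far_set K [set` r] c0 z /\ 0 < Delta z]) _).
      apply: ler_sum => z _; case: ifP => // _; by rewrite le_max lexx.
    move=> z Kz; rewrite inE /far_set /= => -[[_ zf] _] x xn.
    by move: zf; rewrite (dist2_set_nearest xn) lee_fin.
  + rewrite (fsbig_finsupp (c := Delta)) => [|z zD]; last by rewrite fsfun_dflt // normr0.
    apply: (@le_trans _ _ delta); last lra.
    apply: le_trans (minimizer_neg cK (fun x xm => rK x (mur x xm)) DeltaK mu0
      phiB phiO epsd Dmin).
    apply: ler_sum => z _; case: ifPn => [|_]; last by rewrite le_max lexx orbT.
    by rewrite inE /= => Dz; rewrite ltr0_norm // le_max lexx.
- move=> x /= xr.
  rewrite (fsbig_finsupp (c := Delta)) => [|z zD]; last by rewrite fsfun_dflt.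
  have muK z : z \in finsupp mu -> K z by move=> /mur; exact: rK.
  rewrite tv_norm_discrete // fact3.
  have -> : \sum_(z <- finsupp mu) `|mu z| = \sum_(z <- finsupp mu) mu z.
    by apply: eq_bigr => z _; rewrite ger0_norm.
  rewrite -EFinM -EFinD lee_fin.
  have -> : \sum_(z <- finsupp Delta)
        (if z \in [set z | K z /\ dist2 z x <= c0] then Delta z else 0) =
      \sum_(z <- finsupp Delta) (if dist2 z x <= c0 then Delta z else 0).
    rewrite big_seq [RHS]big_seq; apply: eq_bigr => z /DeltaK Kz.
    by congr (if _ then _ else _); apply/idP/idP; rewrite inE /= => //; case.
  have M0 : 0 <= \sum_(z <- finsupp mu) mu z by exact: sumr_ge0.
  set B := 6 * 2 * s%:R * pi ^+ 2 / (diam K ^+ 2 * D).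
  have B0 : 0 <= B.
    apply: divr_ge0; first by rewrite !mulr_ge0 ?pi_ge0.
    by apply: mulr_ge0; [exact: sqr_ge0|exact: ltW].
  (* If [K] is the single point [x], testing against the constant 1 gives an error of at most
     [2 * delta]. *)
  have [[z [Kz zx]]|Kx] := pselect (exists z, K z /\ z != x); last first.
    have KE z : K z -> z = x.
      by move=> Kz; apply: contrapT => /eqP zx; apply: Kx; exists z.
    have q1 z : K z -> `|peval 1 z| <= 1 :> R by rewrite peval1 normr1.
    have := minimizer_moment cK muK DeltaK phiB phiO epsd Dmin ler01 (deg_le1 d) q1.
    have -> : \sum_(z <- finsupp mu) mu z * peval 1 z = mu x.
      have [xm|xm] := boolP (x \in finsupp mu).
        rewrite (bigD1_seq x) ?fset_uniq //= peval1 mulr1 big_seq_cond big1 ?addr0 //.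
        by move=> w /andP[/muK /KE ->]; rewrite eqxx.
      rewrite fsfun_dflt // big_seq big1 // => w wm.
      by move: xm; rewrite -(KE w (muK w wm)) wm.
    have -> : \sum_(z <- finsupp Delta) Delta z * peval 1 z =
        \sum_(z <- finsupp Delta) (if dist2 z x <= c0 then Delta z else 0).
      rewrite big_seq [RHS]big_seq; apply: eq_bigr => z /DeltaK /KE ->.
      by rewrite dist2xx c00 peval1 mulr1.
    rewrite distrC mulr1 => le_h; apply: le_trans le_h _.
    have : 0 <= m%:R^-1 * \sum_(z <- finsupp mu) mu z.
      by rewrite mulr_ge0 ?invr_ge0 ?(ltW m0).
    have : 0 <= B * delta by rewrite mulr_ge0.
    lra.
  have [g0 kB] := DK x z xr Kz zx.
  have [q [qdeg qL q1 q0]] := hL x xr.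
  have qd : deg_le d q.
    have qm : (msize q <= m)%N.
      rewrite -(ler_nat R); apply: le_trans qdeg _; apply: le_trans mL.
      by rewrite lerDr divr_ge0 ?mulr_ge0 ?ltW //; lra.
    (* Here [msize q <= m] means degree at most m - 1, and g > 0 gives m - 1 <= 2 (m - 1) g <= d. *)
    apply: leq_trans qm _; rewrite -(subnK (ltnW m2)) addn1 ltnS.
    apply: leq_trans dm; rewrite mulnAC -[leqLHS]mul1n leq_mul //.
    by rewrite muln_gt0 g0.
  have Lb : L * c0 ^+ 2 <= m%:R^-1.
    rewrite c02 (_ : L * _ = 6 * L / D / m%:R ^+ 2); last by rewrite [in LHS]invfM; ring.
    by rewrite ler_pdivrMr ?exprn_gt0 // expr2 mulKf ?gt_eqF //; lra.
  have := local_mass_error cK rK mur DeltaK mu0 phiB phiO epsd Dmin xr L1 c00 qd qL q1 q0 Lb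
    (far_sum (fun z => all (fun x' => c0 < dist2 z x') r) _).
  have h1 : forall z, K z -> all (fun x' => c0 < dist2 z x') r ->
      forall x, nearest r z x -> c0 <= dist2 z x.
    by move=> w _ /allP le_h x' [x'r _]; apply: ltW; exact: le_h.
  move=> /(_ h1) le_h; apply: le_trans le_h _.
  rewrite lerD2l mulrA -mulrDl ler_wpM2r //.
  move: kB; rewrite /kap -/B; have : 0 <= s%:R :> R by []. 
  lra.
Qed.
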